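(* Let $D$ be a connected locally semicomplete digraph on $n\ge 3$ vertices, and let $C_1,C_2,\dots,C_\ell$ be the acyclic ordering of the strong components of $D$. Let $\sigma^{hc}_{\max}=0$ if $D$ has no Hamilton oriented cycle, and otherwise let $\sigma^{hc}_{\max}$ be the maximum of $\sigma^+(R)$ over all Hamilton oriented cycles $R$ in $D$. Then: (i) if $D$ is not strong and $U(D)$ is 2-connected, then $\sigma^{hc}_{\max}=n-d(C_1,C_\ell)$; (ii) if $D$ is not strong and $U(D)$ is not 2-connected, then $\sigma^{hc}_{\max}=0$; (iii) if $D$ is strong, then $\sigma^{hc}_{\max}=n$. Furthermore, if $D$ has a Hamilton oriented cycle, a Hamilton oriented cycle of $D$ with the maximum number of forward arcs can be found in time polynomial in the size of $D$.
   Context: For $x\in V(D)$, $N^+(x)=\{y: xy\in A(D)\}$ and $N^-(x)=\{y: yx\in A(D)\}$. A semicomplete digraph is obtained from a complete graph by replacing each edge $\{x,y\}$ by the arc $xy$, the arc $yx$, or both. $D$ is locally semicomplete if for every $x\in V(D)$ both $D[N^+(x)]$ and $D[N^-(x)]$ are semicomplete. $U(D)$ is the underlying undirected (multi)graph of $D$; $D$ is connected if $U(D)$ is connected, and strong if for every ordered pair $x,y$ there is a directed path from $x$ to $y$. Strong components are maximal strong subdigraphs; an acyclic ordering $C_1,\dots,C_\ell$ of them is one with no arc from $C_j$ to $C_i$ for $i<j$ (for a connected locally semicomplete digraph this ordering is unique). For vertex-disjoint subgraphs $S,T$, an $(S,T)$-path is a directed path $p_1\dots p_t$ with $p_1\in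 V(S)$, $p_t\in V(T)$ and all other vertices outside $S\cup T$; $d(S,T)$ is the length (number of arcs) of a shortest $(S,T)$-path. An oriented cycle $R=v_1\dots v_mv_1$ in $D$ is a cyclic sequence of distinct vertices with consecutive ones (indices mod $m$) adjacent in $D$; it is Hamilton if it contains all vertices. The pair $v_i,v_{i+1}$ is a forward arc if $v_iv_{i+1}\in A(D)$ and backward otherwise; $\sigma^+(R)$ is the number of forward arcs. *)

(* Defs.v *)
From mathcomp Require Import all_boot.

Set Implicit Arguments.
Unset Strict Implicit.
Unset Printing Implicit Defensive.

(* A digraph is an irreflexive relation e on a finite type: no loops, no       *)
(* parallel arcs, but x -> y and y -> x may both be arcs.                      *)

Section Digraphs.

Variable T : finType.
Implicit Types (e : rel T) (A B C X : {set T}) (s p : seq T) (x y : T).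

Definition induced e A : rel T :=
  [rel x y | [&& x \in A, y \in A & e x y]].

(* The adjacency relation of U(D); edge multiplicities play no role below.     *)
Definition adjacent e : rel T := [rel x y | e x y || e y x].

Definition out_nbr e x : {set T} := [set y | e x y].
Definition in_nbr e x : {set T} := [set y | e y x].

Definition semicomplete_on e A : bool :=
  [forall x in A, forall y in A, (x != y) ==> adjacent e x y].

Definition locally_semicomplete e : bool :=
  [forall x, semicomplete_on e (out_nbr e x)
             && semicomplete_on e (in_nbr e x)].

Definition strong_on e A : bool :=
  [forall x in A, forall y in A, connect (induced e A) x y].

Definition strong e : bool := strong_on e [set: T].

Definition connected_on e A : bool := strong_on (adjacent e) A.

Definition connected e : bool := connected_on e [set: T].

(* U(D) is k-connected.                                                        *)
Definition k_connected k e : bool :=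
  (k < #|T|) && [forall X : {set T}, (#|X| < k) ==> connected_on e (~: X)].

(* A maximal strong subdigraph is induced, so it is given by its vertex set.   *)
Definition strong_component e C : bool := maxset (strong_on e) C.

Definition acyclic_ordering e (Cs : seq {set T}) : Prop :=
  [/\ uniq Cs, Cs =i strong_component e
    & forall i j, i < j < size Cs ->
        forall x y, x \in nth set0 Cs j -> y \in nth set0 Cs i -> ~~ e x y].

(* The vertices of the path are x :: p, so its length is size p;               *)
(* behead (belast x p) lists its internal vertices.                            *)
Definition set_path e A B x p : bool :=
  [&& path e x p, uniq (x :: p), x \in A, last x p \in B
    & all [pred y | y \notin A :|: B] (behead (belast x p))].

Definition is_set_dist e A B d : Prop :=
  (exists x p, set_path e A B x p /\ size p = d) /\
  (forall x p, set_path e A B x p -> d <= size p).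

Definition oriented_cycle e s : bool := ucycleb (adjacent e) s.

Definition hamilton_oriented_cycle e s : bool :=
  oriented_cycle e s && [forall x, x \in s].

Definition forward_arcs e s : nat := count (fun x => e x (next s x)) s.

(* Every Hamilton oriented cycle lists #|T| vertices; the maximum over the     *)
(* empty range is 0.                                                           *)
Definition sigma_hc_max e : nat :=
  \max_(s : #|T|.-tuple T | hamilton_oriented_cycle e s) forward_arcs e s.

Definition digraph_size e : nat := #|T| + #|[set u : T * T | e u.1 u.2]|.

End Digraphs.

(* Random access machine programs: natural-number variables and arrays, each   *)
(* named by a number, with unit-cost access, addition and truncated            *)
(* subtraction. There is deliberately no unit-cost multiplication: each step   *)
(* lengthens numbers by at most one bit, hence polynomial time on this machine *)
(* is polynomial time on Turing machines.                                      *)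

Inductive expr : Type :=
| Cst of nat
| Var of nat
| Get of nat & expr
| Add of expr & expr
| Sub of expr & expr.

Inductive cmd : Type :=
| Skip
| Assign of nat & expr
| Put of nat & expr & expr
| Seq of cmd & cmd
| If of expr & cmd & cmd
| While of expr & cmd.

Record state : Type := State {
  vars : nat -> nat;
  arrs : nat -> nat -> nat
}.

Definition set_var (st : state) (x v : nat) : state :=
  State (fun y => if y == x then v else vars st y) (arrs st).

Definition set_cell (st : state) (a i v : nat) : state :=
  State (vars st)
        (fun b j => if (b == a) && (j == i) then v else arrs st b j).

Fixpoint eval (st : state) (E : expr) : nat :=
  match E with
  | Cst c => c
  | Var x => vars st x
  | Get a E1 => arrs st a (eval st E1)
  | Add E1 E2 => eval st E1 + eval st E2
  | Sub E1 E2 => eval st E1 - eval st E2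
  end.

Fixpoint expr_cost (E : expr) : nat :=
  match E with
  | Cst _ | Var _ => 1
  | Get _ E1 => (expr_cost E1).+1
  | Add E1 E2 | Sub E1 E2 => (expr_cost E1 + expr_cost E2).+1
  end.

(* exec P st t st' : started in state st, P halts in state st' after t steps.  *)
(* Tests succeed on nonzero values.                                            *)
Inductive exec : cmd -> state -> nat -> state -> Prop :=
| ExecSkip st : exec Skip st 1 st
| ExecAssign x E st :
    exec (Assign x E) st (expr_cost E).+1 (set_var st x (eval st E))
| ExecPut a E1 E2 st :
    exec (Put a E1 E2) st (expr_cost E1 + expr_cost E2).+1
         (set_cell st a (eval st E1) (eval st E2))
| ExecSeq P Q st1 st2 st3 t u :
    exec P st1 t st2 -> exec Q st2 u st3 -> exec (Seq P Q) st1 (t + u) st3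
| ExecIfTrue E P Q st st' t :
    eval st E != 0 -> exec P st t st' ->
    exec (If E P Q) st ((expr_cost E).+1 + t) st'
| ExecIfFalse E P Q st st' t :
    eval st E = 0 -> exec Q st t st' ->
    exec (If E P Q) st ((expr_cost E).+1 + t) st'
| ExecWhileTrue E P st1 st2 st3 t u :
    eval st1 E != 0 -> exec P st1 t st2 -> exec (While E P) st2 u st3 ->
    exec (While E P) st1 ((expr_cost E).+1 + t + u) st3
| ExecWhileFalse E P st :
    eval st E = 0 -> exec (While E P) st (expr_cost E).+1 st.

(* Input: n in variable 0 and the adjacency matrix, row by row, in array 0;    *)
(* everything else is 0.                                                       *)
Definition input_state n (e : rel 'I_n) : state :=
  State (fun x => if x == 0 then n else 0)
        (fun a k => ((a == 0) &&
           [exists i : 'I_n, exists j : 'I_n, (k == i * n + j) && e i j])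
           : nat).

(* Output: the vertex sequence s is stored from cell 0 of array 1 on.          *)
Definition outputs n (st : state) (s : seq 'I_n) : Prop :=
  [seq val v | v <- s] = mkseq (arrs st 1) (size s).

(* Main.v *)
(* Domination: if x -> y, z reaches y and z does not reach x, then x -> z, and dually.
   Hence arcs x -> y spanning several strong components fill in all intermediate arcs.

   Strong case: if a cycle C misses a vertex, some path leaves C at an arc c -> x1 and
   returns; either x1 fits between two consecutive vertices of C, or all of C dominates x1
   and the whole path fits before its end. So cycles grow until they are Hamilton.

   Other case: follow from the initial component the arcs that lead farthest. For the greedy
   path p_0 ... p_d so obtained, the number g(v) of the p_j, j < d, not reachable from v satisfies
   g(u) <= g(v) <= g(u) + 1 for every arc u -> v and rises from 0 to d, so both a path from
   C_1 to C_l and the backward pairs of a Hamilton oriented cycle number at least d. When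
   U(D) is 2-connected, removing p_1, ..., p_{d-1} leaves a connected digraph, hence one with
   a Hamilton path, which p_{d-1}, ..., p_1, traversed backward, closes to a cycle.

   Both constructions grow a cycle by ears found by breadth-first search; a Hamilton path is
   a Hamilton cycle through an extra vertex adjacent to everything. *)
Require Import Defs.
From mathcomp Require Import all_boot zify.

Set Implicit Arguments.
Unset Strict Implicit.
Unset Printing Implicit Defensive.

(** * Cyclic sequences and domination in locally semicomplete digraphs *)

Lemma connect_exit (T : finType) (r : rel T) (P : pred T) x y :
  connect r x y -> P x -> ~~ P y -> exists u v, [/\ r u v, P u & ~~ P v].
Proof.
case/connectP=> p; elim: p x => [|z p IH] x /= => [_ -> Px|].
  by rewrite Px.
case/andP=> rxz pz yE Px nPy; case Pz: (P z); first exact: IH pz yE Pz nPy.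
by exists x, z; rewrite Pz.
Qed.

Lemma path_connect_last (T : finType) (r : rel T) x p y :
  path r x p -> y \in x :: p -> connect r y (last x p).
Proof.
move=> px; rewrite inE => /predU1P[->|yp].
  by apply/connectP; exists p.
case/splitPr: yp px => p1 p2; rewrite cat_path last_cat /= => /and3P[_ _ p2P].
by apply/connectP; exists p2.
Qed.

Lemma count_pairwise (T : eqType) (c : pred T) s :
  pairwise (fun u v => ~~ (c u && c v)) s -> count c s <= 1.
Proof.
elim: s => //= u s IH /andP[/allP us /IH]; case cu: (c u) us => //= us _.
by rewrite (eq_in_count (a2 := pred0)) ?count_pred0 // => v /us /negbTE.
Qed.

Lemma pairwise_or (T : eqType) (r : rel T) s u v :
  pairwise r s -> u \in s -> v \in s -> [\/ u = v, r u v | r v u].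
Proof.
elim: s => //= w s IH /andP[/allP ws /IH{}IH]; rewrite !inE.
case/predU1P=> [->|us] /predU1P[->|vs]; [by constructor 1 | | | exact: IH].
  by constructor 2; apply: ws.
by constructor 3; apply: ws.
Qed.

Lemma map_next (T : eqType) (s : seq T) : uniq s -> map (next s) s = rot 1 s.
Proof.
case: s => // x p Us; rewrite rot1_cons; apply: (@eq_from_nth _ x).
  by rewrite size_map size_rcons.
move=> i; rewrite size_map => lt_i; rewrite (nth_map x) // next_nth mem_nth //.
rewrite index_uniq // nth_rcons; move: lt_i => /=; rewrite ltnS leq_eqVlt.
by case/predU1P=> [->|-> //]; rewrite ltnn eqxx nth_default.
Qed.

Section Arcs.

Variables (T : finType) (e : rel T).

Lemma map_pairmap (f : T -> T) (c : T -> T -> nat) x p y :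
  map f (x :: p) = rcons p y ->
  [seq c u (f u) | u <- x :: p] = pairmap c x (rcons p y).
Proof.
elim: p x => [|z p IH] x /= [-> //].
by move=> E; rewrite -IH //= => -[].
Qed.

Lemma forward_arcs_cons x p : uniq (x :: p) ->
  forward_arcs e (x :: p) = sumn (pairmap (fun u v => nat_of_bool (e u v)) x (rcons p x)).
Proof.
move=> U; rewrite /forward_arcs -sumn_count; congr sumn.
by rewrite -(map_pairmap (f := next (x :: p))) // map_next // rot1_cons.
Qed.

Lemma forward_arcs_rot i s : uniq s -> forward_arcs e (rot i s) = forward_arcs e s.
Proof.
move=> U; rewrite /forward_arcs (eq_count (a2 := fun x => e x (next s x))).
  by apply/permP; rewrite perm_rot.
by move=> x; rewrite next_rot.
Qed.

Lemma forward_arcs_size s : forward_arcs e s <= size s.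
Proof. exact: count_size. Qed.

Lemma pairmap_path (r : rel T) x p :
  path r x p -> sumn (pairmap (fun u v => nat_of_bool (r u v)) x p) = size p.
Proof. by elim: p x => //= y p IH x /andP[-> /IH->]. Qed.

Lemma pairmap_compl (r : rel T) x p :
  sumn (pairmap (fun u v => nat_of_bool (r u v)) x p) +
  sumn (pairmap (fun u v => nat_of_bool (~~ r u v)) x p) = size p.
Proof. by elim: p x => //= y p IH x; rewrite -(IH y); case: (r x y) => /=; lia. Qed.

(* Between t and x0, only backward pairs let g decrease, and each by at most 1. *)
Lemma forward_arcs_potential (g : T -> nat) s x0 t :
  (forall u v, e u v -> g u <= g v <= (g u).+1) ->
  oriented_cycle e s -> x0 \in s -> t \in s ->
  forward_arcs e s <= size s - (g t - g x0).
Proof.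
move=> gP /andP[cs Us] x0s ts; have [i q sE] := rot_to ts.
rewrite -(forward_arcs_rot i) // -(size_rot i).
move: cs Us x0s; rewrite -(rot_cycle i) -(rot_uniq i) -(mem_rot i) sE => cs Us.
have drop x p : path (adjacent e) x p ->
    g x <= g (last x p) + sumn (pairmap (fun u v => nat_of_bool (~~ e u v)) x p).
  elim: p x => [|y p IH] x /=; first by rewrite addn0.
  case/andP=> axy /IH H; move: axy; rewrite /adjacent /=.
  case exy: (e x y) => /= eyx; first by have := gP _ _ exy; lia.
  by have := gP _ _ eyx; lia.
rewrite inE => /predU1P[->|x0q].
  by rewrite subnn subn0 forward_arcs_size.
rewrite forward_arcs_cons //; have := pairmap_compl e t (rcons q t).
rewrite size_rcons /= => <-; rewrite -addnBA ?leq_addr //.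
move: cs => /=; case/splitPr: x0q => q1 q2.
rewrite rcons_cat -cat_rcons cat_path => /andP[/drop + _].
rewrite last_rcons pairmap_cat sumn_cat; lia.
Qed.

End Arcs.

Section LocallySemicomplete.

Variables (T : finType) (e : rel T).
Hypothesis lsd : locally_semicomplete e.

Lemma out_adjacent x y z : e x y -> e x z -> y != z -> e y z || e z y.
Proof.
move=> exy exz yz; have /andP[/forall_inP/(_ y)+ _] := forallP lsd x.
rewrite inE exy => /(_ isT)/forall_inP/(_ z).
by rewrite inE exz => /(_ isT)/implyP/(_ yz).
Qed.

Lemma in_adjacent x y z : e y x -> e z x -> y != z -> e y z || e z y.
Proof.
move=> eyx ezx yz; have /andP[_ /forall_inP/(_ y)] := forallP lsd x.
rewrite inE eyx => /(_ isT)/forall_inP/(_ z).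
by rewrite inE ezx => /(_ isT)/implyP/(_ yz).
Qed.

Lemma dom_in x y z : e x y -> connect e z y -> ~~ connect e z x -> e x z.
Proof.
move=> exy /connectP[p]; elim: p z => [|w p IH] z /=; first by move=> _ <-.
case/andP=> ezw pw yE nzx.
have exw: e x w.
  by apply: IH => //; apply: contra nzx; apply: connect_trans; apply: connect1.
have xz: x != z by apply: contraNneq nzx => ->.
by case/orP: (in_adjacent exw ezw xz) => // /connect1 zx; rewrite zx in nzx.
Qed.

Lemma dom_out x y z : e x y -> connect e x z -> ~~ connect e y z -> e z y.
Proof.
move=> + /connectP[p]; elim: p x => [|w p IH] x exy /=; first by move=> _ ->.
case/andP=> exw pw zE nyz.
apply: (IH w) => //.
have wz: connect e w z by apply/connectP; exists p.
have wy: w != y by apply: contraNneq nyz => <-.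
case/orP: (out_adjacent exw exy wy) => // /connect1 yw.
by rewrite (connect_trans yw wz) in nyz.
Qed.

Lemma insert_out x p c v :
    path e x p -> v \notin x :: p -> c \in x :: p -> e c v ->
  exists p1 p2, p = p1 ++ p2 /\ path e x (p1 ++ v :: p2).
Proof.
elim: p x c => [|y p IH] x c /= => [_ _|/andP[exy py] vn cx ecv].
  by rewrite inE => /eqP-> exv; exists [::], [::]; rewrite /= exv.
have rec c' : c' \in y :: p -> e c' v ->
    exists p1 p2, y :: p = p1 ++ p2 /\ path e x (p1 ++ v :: p2).
  move=> c'y ec'v; have [|p1 [p2 [-> pP]]] := IH y c' py _ c'y ec'v.
    by move: vn; rewrite in_cons => /norP[].
  by exists (y :: p1), p2; rewrite /= exy.
move: cx; rewrite in_cons => /predU1P[cx|cy]; last exact: rec cy ecv.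
have yv: y != v by apply: contraNneq vn => <-; rewrite !inE eqxx orbT.
rewrite cx in ecv; case/orP: (out_adjacent exy ecv yv) => [eyv|evy].
  by apply: (rec y) => //; rewrite mem_head.
by exists [::], (y :: p); rewrite /= ecv evy.
Qed.

Lemma insert_in x p c v :
    path e x p -> v \notin x :: p -> c \in x :: p -> e v c ->
  exists l1 l2, x :: p = l1 ++ l2 /\ sorted e (l1 ++ v :: l2).
Proof.
elim: p x c => [|y p IH] x c /= => [_ _|/andP[exy py] vn cx evc].
  by rewrite inE => /eqP-> evx; exists [::], [:: x]; rewrite /= evx.
have vfirst : e v x ->
    exists l1 l2, [:: x, y & p] = l1 ++ l2 /\ sorted e (l1 ++ v :: l2).
  by move=> evx; exists [::], [:: x, y & p]; rewrite /= evx exy.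
have xv: x != v by apply: contraNneq vn => <-; rewrite mem_head.
case evy: (e v y).
  case/orP: (in_adjacent exy evy xv) => [exv|//].
  by exists [:: x], (y :: p); rewrite /= exv evy.
move: cx; rewrite in_cons => /predU1P[cx|cy]; first by apply: vfirst; rewrite -cx.
have [|[|z l1] [l2 [lE lP]]] := IH y c py _ cy evc.
- by move: vn; rewrite in_cons => /norP[].
- by rewrite /= in lE lP; rewrite -lE /= evy in lP.
case: lE lP => <- -> lP; exists [:: x, y & l1], l2; split=> //.
by rewrite /= exy.
Qed.

Lemma insert_adjacent L c v :
    sorted e L -> v \notin L -> c \in L -> adjacent e c v ->
  exists l1 l2, L = l1 ++ l2 /\ sorted e (l1 ++ v :: l2).
Proof.
case: L => // x p Ls vL cL /orP[ecv|evc]; last exact: insert_in Ls vL cL evc.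
have [p1 [p2 [-> pP]]] := insert_out Ls vL cL ecv.
by exists (x :: p1), p2.
Qed.

Lemma extend_path (A : {set T}) L c w :
    connected_on e A -> sorted e L -> {subset L <= A} ->
    c \in L -> w \in A -> w \notin L ->
  exists v l1 l2, [/\ v \in A, v \notin L, L = l1 ++ l2 & sorted e (l1 ++ v :: l2)].
Proof.
move=> cA sL LA cL wA wL.
have /forall_inP/(_ _ (LA c cL))/forall_inP/(_ _ wA) cw := cA.
have [u [v [/and3P[_ vA auv] uL vL]]] := connect_exit (P := mem L) cw cL wL.
have [l1 [l2 [LE lP]]] := insert_adjacent sL vL uL auv.
by exists v, l1, l2.
Qed.

Lemma hamilton_path_on (A : {set T}) :
    connected_on e A -> A != set0 ->
  exists L, [/\ sorted e L, uniq L & L =i A].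
Proof.
move=> cA /set0Pn[a aA].
have H k : 0 < k <= #|A| ->
    exists L, [/\ sorted e L, uniq L, {subset L <= A} & size L = k].
  elim: k => // -[|k] IH /andP[_ kA].
    by exists [:: a]; split=> // x; rewrite inE => /eqP->.
  have [|L [Ls LU LA Lk]] := IH; first by rewrite (ltnW kA).
  have [w wA wL]: exists2 w, w \in A & w \notin L.
    apply/subsetPn; apply/negP => /subset_leq_card.
    by rewrite (card_uniqP LU) Lk leqNgt kA.
  have [c cL]: exists c, c \in L.
    by case: L Lk {Ls LU LA wL} => // c L _; exists c; rewrite mem_head.
  have [v [l1 [l2 [vA vL LE lP]]]] := extend_path cA Ls LA cL wA wL.
  have pL: perm_eq (l1 ++ v :: l2) (v :: L) by rewrite LE (perm_catCA l1 [:: v] l2).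
  exists (l1 ++ v :: l2); split=> //.
  - by rewrite (perm_uniq pL) /= vL.
  - by move=> x; rewrite (perm_mem pL) inE => /predU1P[->//|/LA].
  - by rewrite (perm_size pL) /= Lk.
have A0: 0 < #|A| by rewrite card_gt0; apply/set0Pn; exists a.
have [|L [Ls LU LA Lk]] := H #|A|; first by rewrite A0 leqnn.
have LeA: {subset L <= enum A} by move=> x /LA; rewrite mem_enum.
have sz: size (enum A) <= size L by rewrite -cardE Lk.
by exists L; split=> // x; have [_ ->] := uniq_min_size LU LeA sz; rewrite mem_enum.
Qed.

Definition reflexive_closure (E : eqType) (r : rel E) : rel E :=
  [rel x y | (x == y) || r x y].

Lemma cycle_splice (E : eqType) (r : rel E) c xs q :
    cycle (reflexive_closure r) (c :: q) -> path r c (rcons xs (head c q)) ->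
  cycle (reflexive_closure r) (c :: xs ++ q).
Proof.
move=> /= cq cxs; have{cxs} : path (reflexive_closure r) c (rcons xs (head c q)).
  by apply: sub_path cxs => x y rxy; apply/orP; right.
case: q cq => [|y q] /= cq; first by rewrite cats0.
rewrite rcons_path rcons_cat cat_path /= => /andP[-> ->].
by case/andP: cq.
Qed.

(* If x1 cannot be inserted anywhere, then c -> x1 forces next c -> x1 all along the cycle,
   so that the ear through x1 can be started at the predecessor of its end. *)
Lemma strong_ear L c0 v :
    strong e -> uniq L -> cycle (reflexive_closure e) L -> c0 \in L -> v \notin L ->
  exists c xs, [/\ c \in L, xs != [::], all [predC L] xs
                 & path e c (rcons xs (next L c))].
Proof.
move=> eS UL cL c0L vL.
have con x y : connect e x y.
  have /forall_inP/(_ x (in_setT _))/forall_inP/(_ y (in_setT _)) := eS.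
  by apply: connect_sub => a b /and3P[_ _ /connect1].
have [c1 [x1 [ecx c1L x1L]]] := connect_exit (P := mem L) (con c0 v) c0L vL.
have{}x1L : x1 \notin L := x1L.
have [/exists_inP[d dL /andP[dx xd]]|noins] :=
    boolP [exists d in L, e d x1 && e x1 (next L d)].
  by exists d, [:: x1]; split; rewrite //= ?x1L ?dx ?xd.
have dom d : d \in L -> e d x1.
  have step u : u \in L -> e u x1 -> e (next L u) x1.
    move=> uL ux; have nL: next L u \in L by rewrite mem_next.
    have /predU1P[<- //|un] := next_cycle cL uL.
    have nx: next L u != x1 by apply: contraNneq x1L => <-.
    case/orP: (out_adjacent un ux nx) => // xn.
    by case/exists_inP: noins; exists u; rewrite // ux.
  have iterL k : iter k (next L) c1 \in L /\ e (iter k (next L) c1) x1.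
    by elim: k => //= k [IHL IH]; rewrite mem_next; split=> //; apply: step.
  move=> dL; have := fconnect_cycle (cycle_next UL) c1L d.
  rewrite dL => /iter_findex <-.
  by case: (iterL (findex (next L) c1 d)).
have [p px lp] := connectP (con x1 c0).
have hp: has (mem L) p.
  apply/hasP; exists c0 => //; case: p lp {px} => [/= lp|y p -> /=]; last exact: mem_last.
  by rewrite -lp c0L in x1L.
case/split_find: hp px => c' p1 p2 c'L p1L; rewrite cat_path => /andP[px _].
exists (prev L c'), (x1 :: p1); split=> //; first by rewrite mem_prev.
  by rewrite /= x1L; apply/allP=> z zp; apply: contraNN p1L => zL; apply/hasP; exists z.
by rewrite /= next_prev // px andbT dom ?mem_prev.
Qed.

Lemma strong_hamilton (x : T) :
  strong e -> exists L, [/\ uniq L, cycle (reflexive_closure e) L & L =i predT].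
Proof.
move=> eS; have H k : 0 < k -> exists L, [/\ uniq L, cycle (reflexive_closure e) L
    & (0 < size L) && (minn k #|T| <= size L)].
  elim: k => // -[|k] IH _; first by
    exists [:: x]; rewrite /reflexive_closure /= eqxx; split=> //; lia.
  have [//|L [UL cL /andP[L0 kL]]] := IH.
  have [LT|] := leqP #|T| (size L); first by exists L; split=> //; lia.
  move=> ltL; have [v vL]: exists v, v \notin L.
    apply/existsP; rewrite -negb_forall; apply/negP=> /forallP TL.
    move: ltL; rewrite ltnNge -(card_uniqP UL) => /negP[].
    by apply/subset_leq_card/subsetP=> y _; apply: TL.
  have [c0 c0L]: exists c, c \in L by case: (L) L0 => // c s _; exists c; rewrite mem_head.
  have [c [xs [cL' xs0 xsL pxs]]] := strong_ear eS UL cL c0L vL.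
  have [i q LE] := rot_to cL'.
  have nE: next L c = head c q.
    by rewrite -(next_rot i) // LE; case: (q) => [|y r] /=; rewrite eqxx.
  have : path e c (rcons xs (head c q)) by rewrite -nE.
  have lastN: last c xs \notin L.
    by case: xs xs0 xsL {pxs} => // x1 xs _ /allP H; apply: H (mem_last _ _).
  rewrite rcons_path => /andP[pc]; move: pc lastN.
  case/shortenP=> ys pys /= /andP[cys Uys] subys lastN lx.
  have Lq z : (z \in L) = (z \in c :: q) by rewrite -LE mem_rot.
  have UC : uniq (c :: q) by rewrite -LE rot_uniq.
  have CC : cycle (reflexive_closure e) (c :: q) by rewrite -LE rot_cycle.
  have sz : size L = (size q).+1 by rewrite -(size_rot i) LE.
  exists (c :: ys ++ q); split.
  - move: UC; rewrite /= mem_cat negb_or cys cat_uniq Uys => /andP[-> ->].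
    rewrite /= andbT; apply/hasPn=> z zq; apply/negP=> /= /subys.
    by move/(allP xsL); rewrite /= Lq inE zq orbT.
  - by apply: cycle_splice; rewrite ?rcons_path ?pys.
  rewrite /= size_cat; move: kL; rewrite sz.
  case: ys lastN {pys cys Uys subys lx} => [/negP[] //|] /=; lia.
have [//|L [UL cL /andP[_ kL]]] := H #|T|.+1.
exists L; split=> // y; have sub : {subset L <= enum T} by move=> z _; rewrite mem_enum.
have [|_ ->] := uniq_min_size UL sub; last by rewrite mem_enum.
by rewrite -cardE; move: kL; rewrite (minn_idPr (leqnSn _)).
Qed.

End LocallySemicomplete.

(** * Greedy paths *)

Definition farthest (T : finType) (e : rel T) : rel T :=
  [rel x y | e x y && [forall z, e x z ==> connect e z y]].

(* X lists the internal vertices of the path. *)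
Record greedy_path (T : finType) (e : rel T) (x0 t : T) (X : seq T) : Prop := GreedyPath {
  greedy_source : forall v, connect e x0 v;
  greedy_sink : forall v, connect e v t;
  greedy_farthest : path (farthest e) x0 (rcons X t);
  greedy_nonterminal : all (fun x => ~~ connect e t x) (x0 :: X)
}.

Lemma exit_arc (T : finType) (e : rel T) (lsd : locally_semicomplete e) x t :
  connect e x t -> ~~ connect e t x -> exists2 y, e x y & ~~ connect e y x.
Proof.
move=> xt tx; have [|u [v [euv ux vx]]] := connect_exit (P := fun u => connect e u x) xt _ tx.
  exact: connect0.
by exists v => //; apply: (dom_out lsd euv ux vx).
Qed.

Lemma entering_arc (T : finType) (e : rel T) (lsd : locally_semicomplete e) s y :
  connect e s y -> ~~ connect e y s -> exists2 x, e x y & ~~ connect e y x.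
Proof.
move=> sy ys.
have [|u [v [euv yu /negbNE yv]]] :=
    connect_exit (P := fun u => ~~ connect e y u) sy ys; first by rewrite connect0.
by exists u => //; apply: (dom_in lsd euv yv yu).
Qed.

Lemma greedy_exists (T : finType) (e : rel T) x0 t :
    locally_semicomplete e ->
    (forall u v, connect e u v || connect e v u) ->
    (forall v, connect e x0 v) -> (forall v, connect e v t) -> ~~ connect e t x0 ->
  exists X, greedy_path e x0 t X.
Proof.
move=> lsd tot src snk tx0.
suff H k x : #|[pred z | connect e x z]| <= k -> ~~ connect e t x ->
    exists X, path (farthest e) x (rcons X t) /\ all (fun x => ~~ connect e t x) (x :: X).
  by have [X [? ?]] := H _ x0 (leqnn _) tx0; exists X; split.
elim: k x => [|k IH] x kx tx.
  by move: kx; rewrite leqn0 => /eqP/card0_eq/(_ x); rewrite inE connect0.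
have [y0 exy0 y0x] := exit_arc lsd (snk x) tx.
have [ext|next] := boolP (e x t).
  exists [::]; rewrite /= tx /farthest /= ext; split=> //; rewrite andbT.
  by apply/forall_inP=> z _; apply: snk.
pose y := [arg min_(y < y0 | e x y) #|[pred z | connect e y z]|].
have [exy ymin] : e x y /\ forall z, e x z -> connect e z y.
  rewrite /y; case: arg_minnP => // {}y exy ymin; split=> // z exz.
  have /orP[//|yz] := tot z y; apply/negPn/negP=> zy.
  have := ymin z exz; rewrite leqNgt => /negP[]; apply: proper_card.
  apply/properP; split; first by apply/subsetP=> w; rewrite !inE; apply: connect_trans.
  by exists y; rewrite !inE ?connect0 // zy.
have yx: ~~ connect e y x.
  by apply: contra y0x; apply: connect_trans; apply: ymin.
have ty: ~~ connect e t y.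
  by apply: contra next => ty; apply: (dom_in lsd exy ty tx).
have [|X [pX aX]] := IH y _ ty.
  rewrite -ltnS; apply: leq_trans kx; apply: proper_card; apply/properP; split.
    by apply/subsetP=> w; rewrite !inE; apply: connect_trans; apply: connect1.
  by exists x; rewrite !inE ?connect0.
exists (y :: X); split; last by rewrite /= tx.
by rewrite /= pX andbT /farthest /= exy; apply/forall_inP.
Qed.

Section Greedy.

Variables (T : finType) (e : rel T).
Hypotheses (lsd : locally_semicomplete e)
           (tot : forall u v, connect e u v || connect e v u).
Variables (x0 t : T) (X : seq T).
Hypothesis gP : greedy_path e x0 t X.

Let before u v := ~~ connect e v u && [forall z, e u z ==> connect e z v].

Lemma farthest_strict x y : farthest e x y -> ~~ connect e t x -> ~~ connect e y x.
Proof.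
case/andP=> _ /forall_inP far tx.
have [z exz zx] := exit_arc lsd (greedy_sink gP x) tx.
by apply: contra zx; apply: connect_trans; apply: far.
Qed.

Lemma greedy_pairwise : pairwise before (x0 :: rcons X t).
Proof.
have := greedy_farthest gP; have := greedy_nonterminal gP.
elim: X (x0) => [|y s IH] x /=.
  rewrite !andbT => tx /andP[xt far].
  by rewrite /before tx far.
case/and3P=> tx ty ts /andP[fxy ps].
have /= /andP[-> ->] := IH y (introT andP (conj ty ts)) ps.
rewrite !andbT /=; have yx := farthest_strict fxy tx.
case/andP: fxy => exy /forall_inP far.
apply/andP; split; first by rewrite /before yx; apply/forall_inP.
have pe : path e y (rcons s t) by apply: sub_path ps => u v /andP[].
apply/allP=> z zs; have yz : connect e y z.
  case/splitPr: zs pe => p1 p2; rewrite -cat_rcons cat_path => /andP[p1P _].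
  by apply/connectP; exists (rcons p1 z); rewrite ?last_rcons.
rewrite /before; apply/andP; split; last first.
  by apply/forall_inP=> w /far wy; apply: connect_trans yz.
by apply: contra yx; apply: connect_trans.
Qed.

Lemma greedy_uniq : uniq (x0 :: rcons X t).
Proof.
apply: (@pairwise_uniq _ before); first by move=> x; rewrite /before connect0.
exact: greedy_pairwise.
Qed.

Lemma before_target x y z w :
  connect e x z -> e x y -> before z w -> ~~ connect e y z -> connect e y w.
Proof.
move=> xz exy /andP[_ /forall_inP far] yz; apply: far.
exact: dom_out exy xz yz.
Qed.

Definition greedy_level v := count (fun p => ~~ connect e v p) (x0 :: X).

Lemma greedy_level_step x y : e x y -> greedy_level x <= greedy_level y <= (greedy_level x).+1.
Proof.
move=> exy; have sub p : connect e y p -> connect e x p.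
  by apply: connect_trans; apply: connect1.
apply/andP; split.
  by apply: sub_count => p; apply: contra; apply: sub.
pose c p := connect e x p && ~~ connect e y p.
have -> : greedy_level y = count c (x0 :: X) + greedy_level x.
  rewrite /greedy_level; elim: (x0 :: X) => //= p s ->; have := sub p; rewrite /c.
  case: (connect e y p) => [/(_ isT) ->|_] /=; first by lia.
  by case: (connect e x p) => /=; lia.
rewrite -add1n leq_add2r; apply: count_pairwise.
have: pairwise before (x0 :: X).
  by have := greedy_pairwise; rewrite -rcons_cons pairwise_rcons => /andP[].
apply: sub_pairwise => u v uv; apply/negP=> /andP[/andP[xu yu] /andP[_ /negP yv]].
by apply: yv; apply: before_target xu exy uv yu.
Qed.

Lemma greedy_level_initial v : connect e v x0 -> greedy_level v = 0.
Proof.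
move=> vx0; rewrite /greedy_level (eq_count (a2 := pred0)) ?count_pred0 // => p.
by rewrite (connect_trans vx0 (greedy_source gP p)).
Qed.

Lemma greedy_level_terminal v : connect e t v -> greedy_level v = (size X).+1.
Proof.
move=> tv; apply/eqP; rewrite -[(size X).+1]/(size (x0 :: X)) -all_count.
apply: sub_all (greedy_nonterminal gP) => p; apply: contra.
exact: connect_trans.
Qed.

Lemma greedy_upper s :
  hamilton_oriented_cycle e s -> forward_arcs e s <= #|T| - (size X).+1.
Proof.
case/andP=> cs /forallP all_s; have /andP[_ Us] := cs.
have -> : #|T| = size s.
  by rewrite -(card_uniqP Us); apply: eq_card => x; rewrite all_s.
have := forward_arcs_potential greedy_level_step cs (all_s x0) (all_s t).
by rewrite greedy_level_terminal ?connect0 // greedy_level_initial ?connect0 // subn0.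
Qed.

Lemma source_notin : x0 \notin X.
Proof. by have := greedy_uniq; rewrite /= mem_rcons inE negb_or => /andP[/andP[]]. Qed.

Lemma sink_notin : t \notin X.
Proof. by have := greedy_uniq; rewrite /= rcons_uniq => /and3P[]. Qed.

Lemma greedy_before_source p : p \in rcons X t -> ~~ connect e p x0.
Proof.
have /andP[/allP H _] := greedy_pairwise.
by move=> /H /andP[].
Qed.

Hypothesis two_conn : forall u a b, a != u -> b != u ->
  connect (induced (adjacent e) (~: [set u])) a b.

(* If all in-neighbours of v in earlier components were on the greedy path, then removing one
   of them, u, leaves an arc that jumps over u; by domination it yields another in-neighbour,
   and the greedy choice at u or before rules out that this one is on the path too. *)
Lemma entering_arc_avoiding v : v \notin X -> ~~ connect e v x0 ->
  exists u, [/\ u \notin X, e u v & ~~ connect e v u].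
Proof.
move=> vX vx0; have [u euv vu] := entering_arc lsd (greedy_source gP v) vx0.
have [uX|] := boolP (u \in X); last by exists u.
have pw : pairwise before X.
  by have := greedy_pairwise; rewrite /= pairwise_rcons => /and3P[].
have ux0 : ~~ connect e u x0 by rewrite greedy_before_source // mem_rcons inE uX orbT.
have x0u : x0 != u by apply: contraNneq ux0 => <-.
have v_u : v != u by apply: contraNneq vX => ->.
have [w [z [/and3P[wu zu /= wz] cwu zu']]] :=
  connect_exit (P := fun w => connect e w u) (two_conn x0u v_u) (greedy_source gP u) vu.
rewrite !inE in wu zu.
have ewz : e w z.
  by case/orP: wz => // /connect1 zw; rewrite (connect_trans zw cwu) in zu'.
have [vz|vz] := boolP (connect e v z).
  have vw : ~~ connect e v w by apply: contra vu => vw; apply: connect_trans cwu.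
  have ewv := dom_in lsd ewz vz vw.
  have [wX|wX] := boolP (w \in X); last by exists w.
  have [E|/andP[_ /forall_inP far]|/andP[/negP[] //]] := pairwise_or pw wX uX.
    by rewrite E eqxx in wu.
  by rewrite (far _ ewv) in vu.
have uz : connect e u z by have := tot u z; rewrite (negbTE zu') orbF.
have ezv := dom_out lsd euv uz vz.
have [zX|zX] := boolP (z \in X); last by exists z.
have [E|/andP[_ /forall_inP far]|/andP[/negP[] //]] := pairwise_or pw uX zX.
  by rewrite E eqxx in zu.
by rewrite (far _ euv) in vz.
Qed.

Lemma greedy_complement_connected : connected_on e (~: [set x in X]).
Proof.
pose r := induced (adjacent e) (~: [set x in X]).
have rsym : connect_sym r.
  by apply: sym_connect_sym => a b; rewrite /r /induced /adjacent /= andbCA orbC.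
suff H k v : #|[pred w | connect e w v]| <= k -> v \notin X -> connect r v x0.
  apply/forall_inP=> a; rewrite !inE => aX; apply/forall_inP=> b; rewrite !inE => bX.
  by apply: connect_trans (H _ a (leqnn _) aX) _; rewrite rsym; apply: H bX.
elim: k v => [|k IH] v kv vX.
  by move: kv; rewrite leqn0 => /eqP/card0_eq/(_ v); rewrite inE connect0.
have [vx0|vx0] := boolP (connect e v x0).
  have [p pv pE] := connectP vx0.
  elim: p v vX pv {vx0 kv} pE => [|w p IHp] v vX /=; first by move=> _ ->.
  case/andP=> evw pw lE; have wX : w \notin X.
    apply: contraL (isT) => wX; have := @greedy_before_source w.
    rewrite mem_rcons inE wX orbT => /(_ isT)/negP[].
    by apply/connectP; exists p.
  apply: connect_trans (IHp w wX pw lE); apply: connect1.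
  by rewrite /r /induced /adjacent /= !inE vX wX evw.
have [u [uX euv vu]] := entering_arc_avoiding vX vx0.
apply: (@connect_trans _ _ u).
  by apply: connect1; rewrite /r /induced /adjacent /= !inE vX uX euv orbT.
apply: IH uX; rewrite -ltnS; apply: leq_trans kv; apply: proper_card; apply/properP; split.
  by apply/subsetP=> w; rewrite !inE => wu; apply: connect_trans wu (connect1 euv).
by exists v; rewrite !inE ?connect0.
Qed.

End Greedy.

Section GreedyCycle.

Variables (T : finType) (e : rel T).
Hypothesis lsd : locally_semicomplete e.
Variables (x0 t : T) (X : seq T).
Hypothesis gP : greedy_path e x0 t X.

Lemma greedy_cycle L :
    sorted e L -> uniq L -> L =i [predC X] ->
  hamilton_oriented_cycle e (L ++ rev X) /\
  #|T| - (size X).+1 <= forward_arcs e (L ++ rev X).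
Proof.
move=> sL UL LX; have x0L : x0 \in L by rewrite LX; apply: (source_notin lsd gP).
have tL : t \in L by rewrite LX; apply: (sink_notin lsd gP).
have UX : uniq X.
  by have /= := greedy_uniq lsd gP; rewrite rcons_uniq => /and3P[].
case: L => // h p in sL UL LX x0L tL *.
have hx0 : connect e h x0 by apply: path_connect x0L.
have tl : connect e t (last h p) by apply: path_connect_last tL.
have pX : path e h (rcons X (last h p)).
  have := greedy_farthest gP; have := greedy_nonterminal gP.
  have pE : path (farthest e) x0 (rcons X t) -> path e x0 (rcons X t).
    by apply: sub_path => u v /andP[].
  move=> /allP nt /pE; rewrite !rcons_path => /andP[pX lt].
  have tlX := nt _ (mem_last x0 X).
  have ll : e (last x0 X) (last h p).
    apply: dom_in lt (greedy_sink gP _) _ => //.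
    by apply: contra tlX; apply: connect_trans.
  case: (X) pX ll (@greedy_before_source _ _ lsd _ _ _ gP) => [|a s] /= pX ll bef.
    apply: dom_out ll (greedy_source gP _) _ => //.
    apply/negP=> lh; have := nt x0 (mem_head _ _).
    by rewrite (connect_trans tl) // (connect_trans lh).
  case/andP: pX => xa ->; rewrite ll !andbT.
  apply: dom_out xa (greedy_source gP _) _ => //.
  apply/negP=> ah; have := bef a; rewrite mem_head => /(_ isT)/negP[].
  exact: connect_trans hx0.
have Us : uniq ((h :: p) ++ rev X).
  rewrite cat_uniq UL rev_uniq UX andbT /=; apply/hasPn=> z; rewrite mem_rev => zX.
  by have := LX z; rewrite /= !inE zX => ->.
split; last first.
  rewrite forward_arcs_cons // rcons_cat pairmap_cat sumn_cat pairmap_path //.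
  have <- : size (h :: p) + size X = #|T|.
    rewrite -(size_rev X) -size_cat -(card_uniqP Us); apply: eq_card => z.
    by rewrite mem_cat LX mem_rev !inE orNb.
  by rewrite /=; lia.
apply/andP; split; last first.
  by apply/forallP=> z; rewrite mem_cat LX mem_rev !inE orNb.
apply/andP; split=> //; rewrite /= rcons_cat cat_path.
apply/andP; split; first by apply: sub_path sL => u v; rewrite /adjacent /= => ->.
have := rev_path (adjacent e) h (rcons X (last h p)).
rewrite last_rcons belast_rcons rev_cons => ->.
by apply: sub_path pX => u v; rewrite /adjacent /= => ->; rewrite ?orbT.
Qed.

End GreedyCycle.

(** * The maximum number of forward arcs *)

Lemma cycle_irreflexive (E : eqType) (r : rel E) L :
  uniq L -> 1 < size L -> cycle (reflexive_closure r) L -> cycle r L.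
Proof.
move=> UL szL cL; apply: (cycle_from_next UL) => x xL.
case/predU1P: (next_cycle cL xL) => // xn; have [i q LE] := rot_to xL.
move: szL (UL) xn; rewrite -(size_rot i) -(rot_uniq i) -(next_rot i) // LE.
case: q {LE} => //= y q _; rewrite inE negb_or eqxx => /andP[/andP[/eqP + _] _].
by move=> xy /xy.
Qed.

Section Hamilton.

Variables (T : finType) (e : rel T).

Lemma sorted_connected_on (L : seq T) (A : {set T}) :
  sorted (adjacent e) L -> A =i L -> connected_on e A.
Proof.
move=> sL AL; pose r := induced (adjacent e) A.
have rsym : connect_sym r.
  by apply: sym_connect_sym => a b; rewrite /r /induced /adjacent /= andbCA orbC.
case: L => [|h p] in sL AL *.
  by apply/forall_inP=> x; rewrite AL.
have hr : path r h p.
  apply: (sub_in_path (P := mem A)) sL; last by apply/allP=> z; rewrite -AL.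
  by move=> x y xA yA xy; rewrite /r /induced /= xA yA.
apply/forall_inP=> x; rewrite AL => xL; apply/forall_inP=> y; rewrite AL => yL.
by apply: (@connect_trans _ _ h); [rewrite rsym|]; apply: (path_connect hr).
Qed.

Lemma sorted_connect_total L x y :
  sorted e L -> x \in L -> y \in L -> connect e x y || connect e y x.
Proof.
move=> sL xL; case/splitPr: xL sL => l1 l2 sL; rewrite mem_cat => /orP[yl|yl].
  apply/orP; right; case: l1 yl sL => // h l1 yl; rewrite /= -cat_rcons cat_path => /andP[hP _].
  have := path_connect_last hP (y := y); rewrite last_rcons; apply.
  by rewrite inE mem_rcons inE orbCA -in_cons yl orbT.
by apply/orP; left; apply: path_connect yl; move: sL => /cat_sorted2[].
Qed.

Lemma hamilton_cycle_size s : hamilton_oriented_cycle e s -> size s = #|T|.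
Proof.
case/andP=> /andP[_ Us] /forallP all_s; rewrite -(card_uniqP Us).
by apply: eq_card => x; rewrite all_s.
Qed.

Lemma forward_arcs_cycle s : cycle e s -> forward_arcs e s = size s.
Proof. by move=> cs; apply/eqP; rewrite -all_count; apply/allP=> x; apply: next_cycle. Qed.

Lemma forward_arcs_le_sigma s :
  hamilton_oriented_cycle e s -> forward_arcs e s <= sigma_hc_max e.
Proof.
move=> hs; have szs := introT eqP (hamilton_cycle_size hs).
exact: (@leq_bigmax_cond _ _ (fun s : #|T|.-tuple T => forward_arcs e s) (Tuple szs)).
Qed.

Lemma hamilton_two_connected s :
  2 < #|T| -> hamilton_oriented_cycle e s -> k_connected 2 e.
Proof.
move=> T3 hs; rewrite /k_connected T3; apply/forallP=> X; apply/implyP.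
case/andP: hs => /andP[cs Us] /forallP all_s.
rewrite ltnS leq_eqVlt ltnS leqn0 cards_eq0 => /orP[/cards1P[u ->]|/eqP->].
  have [i q sE] := rot_to (all_s u); move: cs Us (all_s).
  rewrite -(rot_cycle i) -(rot_uniq i) sE /= => + /andP[uq _] mem_s.
  rewrite rcons_path => /andP[/path_sorted sq _].
  apply: sorted_connected_on sq _ => x; rewrite !inE.
  have := mem_s x; rewrite -(mem_rot i) sE inE; case: eqP => [->|] //=.
  by rewrite (negbTE uq).
apply: (@sorted_connected_on s) => [|x]; last by rewrite !inE all_s.
by case: (s) cs => //= h p; rewrite rcons_path => /andP[].
Qed.

Lemma two_connected_remove u a b :
  k_connected 2 e -> a != u -> b != u -> connect (induced (adjacent e) (~: [set u])) a b.
Proof.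
case/andP=> _ /forallP/(_ [set u]); rewrite cards1 => /implyP/(_ isT) /forall_inP/(_ a).
by rewrite !inE => H /H /forall_inP/(_ b); rewrite !inE; apply.
Qed.

Lemma strongP : reflect (forall x y, connect e x y) (strong e).
Proof.
have eE : connect (induced e [set: T]) =2 connect e.
  by apply: eq_connect => x y; rewrite /induced /= !inE.
apply: (iffP forall_inP) => [H x y|H x _].
  by have /forall_inP/(_ y) := H x (in_setT _); rewrite eE; apply.
by apply/forall_inP=> y _; rewrite eE.
Qed.

Hypotheses (lsd : locally_semicomplete e) (conn : connected e).

Lemma hamilton_path (x : T) : exists h p,
  [/\ path e h p, uniq (h :: p), h :: p =i predT & forall u v, connect e u v || connect e v u].
Proof.
have [|L [sL UL LT]] := hamilton_path_on lsd conn.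
  by apply/set0Pn; exists x; rewrite inE.
have {}LT : L =i predT by move=> z; rewrite LT inE.
case: L sL UL LT => [|h p] sL UL LT; first by have := LT x; rewrite in_nil.
exists h, p; split=> // u v.
by apply: sorted_connect_total sL _ _; rewrite LT.
Qed.

Lemma strong_sigma : 2 < #|T| -> strong e -> sigma_hc_max e = #|T|.
Proof.
move=> T3 /[dup] eS /strongP con; have [x _] : exists x : T, x \in T.
  by apply/card_gt0P; apply: leq_trans T3.
have [L [UL cL LT]] := strong_hamilton lsd x eS.
have szL : size L = #|T| by rewrite -(card_uniqP UL); apply: eq_card.
have ce : cycle e L.
  by apply: cycle_irreflexive cL; rewrite ?szL // ltnW.
have hL : hamilton_oriented_cycle e L.
  apply/andP; split; last by apply/forallP=> y; rewrite LT.
  apply/andP; split=> //; apply: sub_cycle ce => u v.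
  by rewrite /adjacent /= => ->.
apply/eqP; rewrite eqn_leq; apply/andP; split.
  by apply/bigmax_leqP => s _; rewrite -[leqRHS](size_tuple s) forward_arcs_size.
by apply: leq_trans (forward_arcs_le_sigma hL); rewrite forward_arcs_cycle ?szL.
Qed.

Section Nonstrong.

Variables (x0 t : T) (X : seq T).
Hypotheses (gP : greedy_path e x0 t X)
           (tot : forall u v, connect e u v || connect e v u)
           (conn2 : k_connected 2 e).

Lemma greedy_sigma : sigma_hc_max e = #|T| - (size X).+1.
Proof.
apply/eqP; rewrite eqn_leq; apply/andP; split.
  by apply/bigmax_leqP => s; apply: (greedy_upper lsd gP).
have c2 u a b := @two_connected_remove u a b conn2.
have [|L [sL UL LX]] := hamilton_path_on lsd (greedy_complement_connected lsd tot gP c2).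
  by apply/set0Pn; exists x0; rewrite !inE (source_notin lsd gP).
have {}LX : L =i [predC X] by move=> x; rewrite LX !inE.
have [hs] := greedy_cycle lsd gP sL UL LX.
by move/leq_trans; apply; apply: forward_arcs_le_sigma.
Qed.

Variable Cs : seq {set T}.
Hypothesis aoCs : acyclic_ordering e Cs.

Lemma component_strong C x y : C \in Cs -> x \in C -> y \in C -> connect e x y.
Proof.
have [_ CsE _] := aoCs; rewrite CsE => /maxsetp /forall_inP H xC yC.
have /forall_inP/(_ y yC) := H x xC.
by apply: connect_sub => a b /and3P[_ _ /connect1].
Qed.

Lemma component_neq0 C : C \in Cs -> exists x, x \in C.
Proof.
have [_ CsE _] := aoCs; rewrite CsE => mC; apply/set0Pn/eqP=> C0.
have s1 : strong_on e [set x0].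
  by apply/forall_inP=> a /set1P->; apply/forall_inP=> b /set1P->; apply: connect0.
have := maxsetsup mC s1; rewrite C0 sub0set => /(_ isT)/setP/(_ x0).
by rewrite !inE eqxx.
Qed.

Lemma component_exists x : exists2 C, C \in Cs & x \in C.
Proof.
have s1 : strong_on e [set x].
  by apply/forall_inP=> a /set1P->; apply/forall_inP=> b /set1P->; apply: connect0.
have [C mC xC] := maxset_exists s1; exists C; last by rewrite -sub1set.
by have [_ -> _] := aoCs.
Qed.

Lemma source_in_head : x0 \in head set0 Cs.
Proof.
have [Cx Cxs xC] := component_exists x0; have Cs0 : 0 < size Cs by case: (Cs) Cxs.
rewrite -nth0; have [y y0] := component_neq0 (mem_nth set0 Cs0).
apply/negPn/negP=> xN.
have [|u [v [euv uN /negbNE v0]]] :=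
    connect_exit (P := fun z => z \notin nth set0 Cs 0) (greedy_source gP y) xN.
  by rewrite y0.
have [C CCs uC] := component_exists u; have [_ _ order] := aoCs.
have C_pos : 0 < index C Cs.
  by rewrite lt0n; apply: contraNneq uN => C0; rewrite -C0 nth_index.
have := order 0 (index C Cs); rewrite C_pos index_mem => /(_ CCs u v).
by rewrite nth_index // euv => /(_ uC v0).
Qed.

Lemma sink_in_last : t \in last set0 Cs.
Proof.
have [Ct Cts tC] := component_exists t; have Cs0 : 0 < size Cs by case: (Cs) Cts.
have lastC : (size Cs).-1 < size Cs by rewrite prednK.
rewrite -nth_last; have [y yl] := component_neq0 (mem_nth set0 lastC).
apply/negPn/negP=> tN.
have [u [v [euv ul vN]]] :=
    connect_exit (P := fun z => z \in nth set0 Cs (size Cs).-1) (greedy_sink gP y) yl tN.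
have [C CCs vC] := component_exists v; have [_ _ order] := aoCs.
have iC : index C Cs < size Cs by rewrite index_mem.
have C_lt : index C Cs < (size Cs).-1.
  by rewrite ltn_neqAle -ltnS prednK // iC andbT; apply: contraNneq vN => <-; rewrite nth_index.
have := order (index C Cs) (size Cs).-1; rewrite C_lt lastC => /(_ isT u v ul).
by rewrite nth_index // euv => /(_ vC).
Qed.

Lemma greedy_set_dist : is_set_dist e (head set0 Cs) (last set0 Cs) (size X).+1.
Proof.
have Cs0 : 0 < size Cs by have [C] := component_exists x0; case: (Cs).
have headC : head set0 Cs \in Cs by rewrite -nth0 mem_nth.
have lastC : last set0 Cs \in Cs by rewrite -nth_last mem_nth // prednK.
have hs := source_in_head; have tl := sink_in_last; split.
  exists x0, (rcons X t); rewrite size_rcons; split=> //; apply/and5P; split=> //.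
  - by apply: sub_path (greedy_farthest gP) => u v /andP[].
  - exact: (greedy_uniq lsd gP).
  - by rewrite last_rcons.
  rewrite belast_rcons /=; apply/allP=> p pX; rewrite /= inE negb_or; apply/andP; split.
    have := @greedy_before_source _ _ lsd _ _ _ gP p.
    rewrite mem_rcons inE pX orbT => /(_ isT); apply: contraNN => ph.
    exact: component_strong headC ph hs.
  have /andP[_ /allP/(_ p pX)] := greedy_nonterminal gP; apply: contraNN => pl.
  exact: component_strong lastC tl pl.
move=> x p /and5P[px _ xh lp _].
have gx : greedy_level e x0 X x = 0.
  by apply: (greedy_level_initial gP); apply: component_strong headC xh hs.
have gl : greedy_level e x0 X (last x p) = (size X).+1.
  by apply: (greedy_level_terminal gP); apply: component_strong lastC tl lp.
rewrite -gl -[size p]addn0 -gx addnC; elim: p x px {xh lp gx gl} => [|z p IH] x /=.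
  by rewrite addn0.
case/andP=> exz /IH lez; have /andP[_ gz] := greedy_level_step lsd gP exz.
by apply: leq_trans lez _; rewrite addnS -addSn leq_add2r.
Qed.

End Nonstrong.

Lemma nonstrong_greedy : 0 < #|T| -> ~~ strong e ->
  exists x0 t X, greedy_path e x0 t X /\ forall u v, connect e u v || connect e v u.
Proof.
move=> /card_gt0P[x _] nS; have [h [p [hp _ hpT tot]]] := hamilton_path x.
have src v : connect e h v by have vp : v \in h :: p by [rewrite hpT]; exact: (path_connect hp vp).
have snk v : connect e v (last h p) by apply: (path_connect_last hp); rewrite hpT.
have nth_ : ~~ connect e (last h p) h.
  apply: contra nS => lh; apply/strongP=> u v.
  exact: connect_trans (snk u) (connect_trans lh (src v)).
have [X gP] := greedy_exists lsd tot src snk nth_.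
by exists h, (last h p), X.
Qed.

End Hamilton.

Lemma sigma_hc_max_spec (T : finType) (e : rel T) (Cs : seq {set T}) :
    irreflexive e -> connected e -> locally_semicomplete e -> 3 <= #|T| ->
    acyclic_ordering e Cs ->
  [/\ ~~ strong e -> k_connected 2 e ->
        exists2 d, is_set_dist e (head set0 Cs) (last set0 Cs) d
                 & sigma_hc_max e = #|T| - d,
      ~~ strong e -> ~~ k_connected 2 e -> sigma_hc_max e = 0
    & strong e -> sigma_hc_max e = #|T|].
Proof.
move=> _ conn lsd T3 aoCs; split=> [nS c2|nS nc2|]; last exact: (strong_sigma lsd T3).
  have [|x0 [t [X [gP tot]]]] := nonstrong_greedy lsd conn _ nS.
    by apply: leq_trans T3.
  exists (size X).+1; first exact: (greedy_set_dist lsd gP aoCs).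
  exact: (greedy_sigma lsd gP tot c2).
apply: big_pred0 => s; apply/negbTE; apply: contra nc2.
exact: hamilton_two_connected.
Qed.

(** * Programs with bounded loops *)

(* The only loops run a counter from 0 to the value of variable 0, inclusive: these programs
   halt in polynomial time, so that only the function run remains to be studied. *)
Inductive prog : Type :=
| PSkip
| PAssign of nat & expr
| PPut of nat & expr & expr
| PSeq of prog & prog
| PIf of expr & prog & prog
| PFor of nat & prog.

Definition incr_var (x : nat) (st : state) : state := set_var st x (vars st x).+1.

Fixpoint run (P : prog) (st : state) : state :=
  match P with
  | PSkip => st
  | PAssign x E => set_var st x (eval st E)
  | PPut a E1 E2 => set_cell st a (eval st E1) (eval st E2)
  | PSeq P Q => run Q (run P st)
  | PIf E P Q => if eval st E != 0 then run P st else run Q st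
  | PFor x P => iter (vars st 0).+1 (fun s => incr_var x (run P s)) (set_var st x 0)
  end.

Fixpoint compile (P : prog) : cmd :=
  match P with
  | PSkip => Skip
  | PAssign x E => Assign x E
  | PPut a E1 E2 => Put a E1 E2
  | PSeq P Q => Seq (compile P) (compile Q)
  | PIf E P Q => If E (compile P) (compile Q)
  | PFor x P =>
      Seq (Assign x (Cst 0))
          (While (Defs.Sub (Add (Var 0) (Cst 1)) (Var x))
                 (Seq (compile P) (Assign x (Add (Var x) (Cst 1)))))
  end.

Fixpoint assigned (P : prog) : seq nat :=
  match P with
  | PSkip | PPut _ _ _ => [::]
  | PAssign x _ => [:: x]
  | PSeq P Q | PIf _ P Q => assigned P ++ assigned Q
  | PFor x P => x :: assigned P
  end.

Fixpoint written (P : prog) : seq nat :=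
  match P with
  | PSkip | PAssign _ _ => [::]
  | PPut a _ _ => [:: a]
  | PSeq P Q | PIf _ P Q => written P ++ written Q
  | PFor _ P => written P
  end.

Fixpoint well_formed (P : prog) : bool :=
  match P with
  | PSkip | PPut _ _ _ => true
  | PAssign x _ => x != 0
  | PSeq P Q | PIf _ P Q => well_formed P && well_formed Q
  | PFor x P => [&& x != 0, x \notin assigned P & well_formed P]
  end.

Fixpoint cost (P : prog) (N : nat) : nat :=
  match P with
  | PSkip => 1
  | PAssign _ E => (expr_cost E).+1
  | PPut _ E1 E2 => (expr_cost E1 + expr_cost E2).+1
  | PSeq P Q => cost P N + cost Q N
  | PIf E P Q => (expr_cost E).+1 + (cost P N + cost Q N)
  | PFor _ P => 8 + N * (10 + cost P N)
  end.

Definition frame (V A : seq nat) (st s : state) : Prop :=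
  (forall x, x \notin V -> vars s x = vars st x) /\
  (forall a i, a \notin A -> arrs s a i = arrs st a i).

Lemma frame_refl V A st : frame V A st st. Proof. by []. Qed.

#[local] Hint Resolve frame_refl : core.

Lemma frame_trans V A st1 st2 st3 :
  frame V A st1 st2 -> frame V A st2 st3 -> frame V A st1 st3.
Proof.
by case=> v1 a1 [v2 a2]; split=> [x xV|a i aA]; rewrite ?v2 ?v1 // a2 ?a1.
Qed.

Lemma frame_sub V A V' A' st s :
  frame V A st s -> {subset V <= V'} -> {subset A <= A'} -> frame V' A' st s.
Proof.
case=> v a VV AA; split=> [x xV|b i bA].
  by apply: v; apply: contra xV; apply: VV.
by apply: a; apply: contra bA; apply: AA.
Qed.

Lemma frame_set_var V A st s x v :
  x \in V -> frame V A st s -> frame V A st (set_var s x v).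
Proof.
move=> xV [vs ars]; split=> //= y yV; case: eqP => [E|_]; last exact: vs.
by rewrite E xV in yV.
Qed.

Lemma frame_set_cell V A st s a i v :
  a \in A -> frame V A st s -> frame V A st (set_cell s a i v).
Proof.
move=> aA [vs ars]; split=> //= b j bA; case: eqP => [E|_] /=; last exact: ars.
by rewrite E aA in bA.
Qed.

Lemma run_frame P st : frame (assigned P) (written P) st (run P st).
Proof.
elim: P st => //= [x E|a E1 E2|P IHP Q IHQ|E P IHP Q IHQ|x P IHP] st.
- by apply: frame_set_var; rewrite ?mem_head.
- by apply: frame_set_cell; rewrite ?mem_head.
- apply: frame_trans (frame_sub (IHP st) _ _) (frame_sub (IHQ _) _ _) => y;
    by rewrite mem_cat => ->; rewrite ?orbT.
- case: ifP => _; [apply: frame_sub (IHP st) _ _|apply: frame_sub (IHQ st) _ _] => y;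
    by rewrite mem_cat => ->; rewrite ?orbT.
suff H k : frame (x :: assigned P) (written P) st
    (iter k (fun s => incr_var x (run P s)) (set_var st x 0)) by exact: H (vars st 0).+1.
elim: k => [|k IH] /=; apply: frame_set_var; rewrite ?mem_head //.
apply: frame_trans IH _.
by apply: frame_sub (IHP _) _ _ => y //; rewrite inE => ->; rewrite orbT.
Qed.

Lemma well_formed_var0 P : well_formed P -> 0 \notin assigned P.
Proof.
elim: P => //= [x E|P IHP Q IHQ /andP[/IHP p /IHQ q]|E P IHP Q IHQ /andP[/IHP p /IHQ q]
  |x P IHP /and3P[x0 _ /IHP p]].
- by rewrite inE eq_sym.
- by rewrite mem_cat negb_or p.
- by rewrite mem_cat negb_or p.
- by rewrite inE negb_or eq_sym x0.
Qed.

Lemma run_for (I : nat -> state -> Prop) x P st :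
    well_formed (PFor x P) ->
    I 0 (set_var st x 0) ->
    (forall i s, i <= vars st 0 -> vars s x = i ->
       frame (assigned (PFor x P)) (written P) st s -> I i s ->
       I i.+1 (set_var (run P s) x i.+1)) ->
  I (vars st 0).+1 (run (PFor x P) st).
Proof.
move=> wf I0 IS; have /and3P[x0 xP wfP] := wf.
pose F := fun s => incr_var x (run P s).
suff H k : k <= (vars st 0).+1 -> let s := iter k F (set_var st x 0) in
    [/\ vars s x = k, frame (assigned (PFor x P)) (written P) st s & I k s].
  by case: (H _ (leqnn _)).
elim: k => [_|k IH lek] /=.
  by split=> //; [rewrite eqxx | apply: frame_set_var; rewrite ?mem_head].
have [sx sf sI] := IH (ltnW lek); set s := iter _ _ _ in sx sf sI *.
have rx : vars (run P s) x = k by rewrite (proj1 (run_frame P s)).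
rewrite /F /incr_var rx; split=> /=; first by rewrite eqxx.
  apply: frame_set_var; rewrite ?mem_head //; apply: frame_trans sf _.
  by apply: frame_sub (run_frame P s) _ _ => y //; rewrite inE => ->; rewrite orbT.
exact: IS.
Qed.

Lemma compile_exec P st : well_formed P ->
  exists2 t, exec (compile P) st t (run P st) & t <= cost P (vars st 0).+1.
Proof.
elim: P st => /= [|x E|a E1 E2|P IHP Q IHQ|E P IHP Q IHQ|x P IHP] st.
- by move=> _; exists 1 => //; constructor.
- by move=> _; eexists; [constructor|].
- by move=> _; eexists; [constructor|].
- case/andP=> wP wQ; have [t1 e1 c1] := IHP st wP; have [t2 e2 c2] := IHQ (run P st) wQ.
  exists (t1 + t2); first exact: ExecSeq e1 e2.
  by rewrite leq_add //; rewrite (proj1 (run_frame P st)) ?well_formed_var0 // in c2.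
- case/andP=> wP wQ; case: eqP => Es.
    have [t2 e2 c2] := IHQ st wQ; exists ((expr_cost E).+1 + t2); first exact: ExecIfFalse.
    by rewrite leq_add2l (leq_trans c2) ?leq_addl.
  have [t1 e1 c1] := IHP st wP.
  exists ((expr_cost E).+1 + t1); first by apply: ExecIfTrue => //; apply/eqP.
  by rewrite leq_add2l (leq_trans c1) ?leq_addr.
case/and3P=> x0 xP wP; have P0 := well_formed_var0 wP.
set F := fun s => incr_var x (run P s); set W := While _ _; set N := vars st 0.
suff H k s : k <= N.+1 -> vars s 0 = N -> vars s x = N.+1 - k ->
    exists2 t, exec W s t (iter k F s) & t <= 6 + k * (10 + cost P N.+1).
  have [||t et ct] := H N.+1 (set_var st x 0) (leqnn _).
  - by rewrite /= eq_sym (negbTE x0).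
  - by rewrite /= eqxx subnn.
  exists (2 + t); last by rewrite -[8]/(2 + 6) -addnA leq_add2l.
  exact: ExecSeq (ExecAssign x (Cst 0) st) et.
elim: k s => [|k IH] s kN s0 sx.
  exists 6 => //; apply: (ExecWhileFalse (E := Defs.Sub _ _)).
  by rewrite /= s0 sx; lia.
have [t1 e1 c1] := IHP s wP; have fP := run_frame P s.
have F0 : vars (F s) 0 = N.
  by rewrite /F /incr_var /= eq_sym (negbTE x0) (proj1 fP).
have Fx : vars (F s) x = N.+1 - k.
  by rewrite /F /incr_var /= eqxx (proj1 fP) // sx; lia.
have [t2 e2 c2] := IH (F s) (ltnW kN) F0 Fx.
exists (6 + (t1 + 4) + t2); last by rewrite s0 in c1; rewrite mulSn; lia.
rewrite iterSr; apply: ExecWhileTrue e2.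
  by rewrite /= s0 sx; lia.
apply: (ExecSeq e1); rewrite /F /incr_var -[(vars _ x).+1]addn1.
exact: (ExecAssign x (Add (Var x) (Cst 1))).
Qed.

Lemma cost_polynomial P : exists c k, forall N, 0 < N -> cost P N <= c * N ^ k.
Proof.
have wk c k c' k' N : 0 < N -> c <= c' -> k <= k' -> c * N ^ k <= c' * N ^ k'.
  by move=> N0 cc kk; rewrite leq_mul // leq_pexp2l.
have const c : exists c' k, forall N, 0 < N -> c <= c' * N ^ k.
  by exists c, 0 => N _; rewrite muln1.
have add f g : (exists c k, forall N, 0 < N -> f N <= c * N ^ k) ->
    (exists c k, forall N, 0 < N -> g N <= c * N ^ k) ->
    exists c k, forall N, 0 < N -> f N + g N <= c * N ^ k.
  move=> [c1 [k1 f1]] [c2 [k2 g2]]; exists (c1 + c2), (k1 + k2) => N N0.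
  rewrite mulnDl leq_add //.
    by apply: leq_trans (f1 N N0) (wk _ _ _ _ _ _ _ _); rewrite ?leq_addr.
  by apply: leq_trans (g2 N N0) (wk _ _ _ _ _ _ _ _); rewrite ?leq_addl.
elim: P => /= [|x E|a E1 E2|P IHP Q IHQ|E P IHP Q IHQ|x P IHP]; try exact: const.
- exact: add.
- exact: (add (fun=> _)) (const _) (add _ _ IHP IHQ).
apply: (add (fun=> _)) => //.
have [c [k ck]] := add (fun=> _) _ (const 10) IHP.
exists c, k.+1 => N N0; rewrite expnS mulnCA leq_mul2l ck ?orbT //.
Qed.

Lemma run_skip st : run PSkip st = st. Proof. by []. Qed.
Lemma run_assign x E st : run (PAssign x E) st = set_var st x (eval st E). Proof. by []. Qed.
Lemma run_put a E1 E2 st : run (PPut a E1 E2) st = set_cell st a (eval st E1) (eval st E2).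
Proof. by []. Qed.
Lemma run_seq P Q st : run (PSeq P Q) st = run Q (run P st). Proof. by []. Qed.
Lemma run_if E P Q st : run (PIf E P Q) st = if eval st E != 0 then run P st else run Q st.
Proof. by []. Qed.

Definition runE := (run_skip, run_assign, run_put, run_seq, run_if).

Arguments run : simpl never.

(** * Breadth-first search *)

Notation Minus := Defs.Sub.
Notation "P ;; Q" := (PSeq P Q) (at level 60, right associativity).
Notation PWhen E P := (PIf E P PSkip).
Notation PUnless E P := (PIf E PSkip P).

Notation vN := 0 (only parsing).
Notation vStart := 1 (only parsing).
Notation vRound := 2 (only parsing).
Notation vC := 3 (only parsing).
Notation vK := 4 (only parsing).
Notation vU := 5 (only parsing).
Notation vW := 6 (only parsing).
Notation vEnd := 7 (only parsing).
Notation vAcc := 8 (only parsing).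
Notation vCur := 9 (only parsing).
Notation vQ := 10 (only parsing).
Notation vDone := 11 (only parsing).
Notation vBest := 12 (only parsing).

(* The current cycle is linked by aNext; aExcl marks the vertices it must avoid, and aMark
   these as well as the vertices on it. *)
Notation aIn := 0 (only parsing).
Notation aOut := 1 (only parsing).
Notation aAdj := 2 (only parsing).
Notation aMul := 3 (only parsing).
Notation aMark := 4 (only parsing).
Notation aNext := 5 (only parsing).
Notation aPar := 6 (only parsing).
Notation aExcl := 7 (only parsing).
Notation aPath := 8 (only parsing).
Notation aQ := 9 (only parsing).

Definition edge (a b : expr) : expr := Get aAdj (Add (Get aMul a) b).
Definition differ (a b : expr) : expr := Add (Minus a b) (Minus b a).

Lemma eval_differ st a b : (eval st (differ a b) != 0) = (eval st a != eval st b).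
Proof. by rewrite /=; lia. Qed.

(* Cell w of array aPar holds 0 when w is not reached, and otherwise u.+1 where u is the
   predecessor of w; the start of the search gets the dummy value 1. *)
Definition bfs_step : prog :=
  PUnless (Get aMark (Var vW)) (PUnless (Get aPar (Var vW))
    (PWhen (edge (Var vU) (Var vW)) (PWhen (Get aPar (Var vU))
      (PPut aPar (Var vW) (Add (Var vU) (Cst 1)))))).

Definition bfs : prog :=
  PFor vW (PPut aPar (Var vW) (Cst 0)) ;;
  PPut aPar (Var vC) (Cst 1) ;;
  PFor vK (PFor vU (PFor vW bfs_step)).

Section Search.

Variables (n : nat) (E : rel nat).
Implicit Types (m : pred nat) (p f : nat -> nat) (st s : state) (xs : seq nat).

Definition graph_state st : Prop :=
  [/\ vars st vN = n, forall u, u <= n -> arrs st aMul u = u * n.+1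
    & forall u w, u <= n -> w <= n -> arrs st aAdj (u * n.+1 + w) = E u w].

Definition marks st m : Prop := forall w, w <= n -> arrs st aMark w = m w.

Lemma graph_frame V A st s :
  frame V A st s -> 0 \notin V -> 2 \notin A -> 3 \notin A -> graph_state st -> graph_state s.
Proof.
move=> [vs ars] V0 A2 A3 [n0 mu ad]; split=> [|u un|u w un wn]; first by rewrite vs.
  by rewrite ars // mu.
by rewrite ars // ad.
Qed.

Lemma marks_frame V A st s m : frame V A st s -> 4 \notin A -> marks st m -> marks s m.
Proof. by move=> [_ ars] A4 mm w wn; rewrite ars // mm. Qed.

Lemma eval_edge st a b : graph_state st -> eval st a <= n -> eval st b <= n ->
  eval st (edge a b) = E (eval st a) (eval st b).
Proof. by case=> _ mu ad an bn; rewrite /= mu // ad. Qed.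

Definition free m : rel nat := fun u w => [&& E u w, ~~ m w & w <= n].
Definition chain m p : rel nat := fun u w => (p w == u.+1) && free m u w.

Definition sound m c p : Prop :=
  p c != 0 /\
  forall w, w <= n -> p w != 0 ->
    exists xs, [/\ path (chain m p) c xs, last c xs = w & uniq (c :: xs)].

Lemma chain_reached m p c xs : path (chain m p) c xs -> all (fun w => p w != 0) xs.
Proof. by elim: xs c => //= x xs IH c /andP[/andP[/eqP-> _] /IH]. Qed.

Lemma sound_update m c p p' u w :
    sound m c p -> u <= n -> p u != 0 -> p w = 0 -> free m u w ->
    p' w = u.+1 -> (forall v, v != w -> p' v = p v) ->
  sound m c p'.
Proof.
move=> [pc sp] un pu pw fuw p'w p'E; split.
  by rewrite p'E //; apply: contraNneq pc => ->; rewrite pw.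
have sub a b : chain m p a b -> chain m p' a b.
  case/andP=> /eqP pb fab; rewrite /chain fab andbT p'E ?pb //.
  by apply: contra_eq_neq pb => ->; rewrite pw.
move=> v vn; have [->|vw] := eqVneq v w; last first.
  rewrite p'E // => /(sp v vn)[xs [px lx ux]]; exists xs; split=> //.
  exact: sub_path px.
move=> _; have [xs [px lx ux]] := sp u un pu; exists (rcons xs w); split.
- by rewrite rcons_path (sub_path sub px) lx /chain p'w eqxx.
- by rewrite last_rcons.
rewrite -rcons_cons rcons_uniq ux andbT inE negb_or; apply/andP; split.
  by apply: contraNneq pc => <-; rewrite pw.
by apply/negP=> /(allP (chain_reached px)); rewrite pw.
Qed.

Lemma bfs_step_spec st m c (p := arrs st aPar) (p' := arrs (run bfs_step st) aPar)
    (u := vars st vU) (w := vars st vW) :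
    graph_state st -> marks st m -> u <= n -> w <= n -> sound m c p ->
  [/\ sound m c p', forall v, p v != 0 -> p' v != 0
    & p u != 0 -> free m u w -> p' w != 0].
Proof.
move=> gst mst un wn sp; rewrite {}/p' /bfs_step !runE /=; rewrite -/p -/u -/w.
rewrite mst //; case mw: (m w) => /=.
  by split=> // _ /and3P[_]; rewrite mw.
have [pw|pw] /= := eqVneq (p w) 0; last by split.
have := @eval_edge st (Var vU) (Var vW) gst un wn; rewrite /= -/u -/w => ->.
case Euw: (E u w) => /=; last by split=> // _ /andP[]; rewrite Euw.
have [pu|pu] /= := eqVneq (p u) 0; first by split=> // /negP[].
have fuw : free m u w by rewrite /free Euw mw.
rewrite addn1 -/w; split.
- apply: (sound_update sp un pu pw fuw) => [|v vw]; first by rewrite eqxx.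
  by rewrite (negbTE vw).
- by move=> v; case: ifP.
by rewrite eqxx.
Qed.

Lemma bfs_spec st m (c := vars st vC) (p := arrs (run bfs st) aPar) :
    graph_state st -> marks st m -> c <= n -> m c ->
  sound m c p /\ forall xs, path (free m) c xs -> p (last c xs) != 0.
Proof.
move=> gst mst cn mc; rewrite {}/p /bfs !runE.
set st1 := run (PFor vW _) st; set st2 := set_cell st1 _ _ _.
have fr1 : frame [:: 6] [:: 6] st st1.
  exact: (run_frame (PFor vW (PPut aPar (Var vW) (Cst 0))) st).
have c1 : vars st1 vC = c by rewrite (proj1 fr1).
have p1 w : w <= n -> arrs st1 aPar w = 0.
  pose I j s := forall w, w < j -> arrs s aPar w = 0.
  suff H : I n.+1 st1 by apply: H.
  have [<- _ _] := gst; apply: run_for => // j s _ sj _ IH v.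
  by rewrite runE ltnS leq_eqVlt /= sj; case: eqP => //= _ /IH.
have fr2 : frame [:: 6] [:: 6] st st2.
  exact: frame_set_cell.
have gst2 : graph_state st2 by apply: graph_frame fr2 _ _ _ gst.
have mst2 : marks st2 m by apply: marks_frame fr2 _ mst.
have c2 : vars st2 vC = c by [].
have p2E w : arrs st2 aPar w = if w == c then 1 else arrs st1 aPar w by rewrite -c1.
have p2c : arrs st2 aPar c = 1 by rewrite p2E eqxx.
have p2 w : w <= n -> w != c -> arrs st2 aPar w = 0.
  by move=> wn wc; rewrite p2E (negbTE wc) p1.
have s2 : sound m c (arrs st2 aPar).
  split=> [|w wn]; first by rewrite p2c.
  have [-> _|wc] := eqVneq w c; last by rewrite p2.
  by exists [::].
pose reach k s := forall xs, path (free m) c xs -> size xs <= k -> arrs s aPar (last c xs) != 0.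
clearbody st2; clear st1 fr1 c1 p1 fr2 p2 p2E.
pose I k s := sound m c (arrs s aPar) /\ reach k s.
have [] : I n.+1 (run (PFor vK (PFor vU (PFor vW bfs_step))) st2).
  have [<- _ _] := gst2; apply: run_for => //.
    by split=> // -[|//] _ _; rewrite /= p2c.
  move=> k s0 _ _ fr0 [so0 re0].
  have gs0 : graph_state s0 by apply: graph_frame fr0 _ _ _ gst2.
  have ms0 : marks s0 m by apply: marks_frame fr0 _ mst2.
  pose mono s := forall v, arrs s0 aPar v != 0 -> arrs s aPar v != 0.
  pose done u w s := arrs s0 aPar u != 0 -> free m u w -> arrs s aPar w != 0.
  pose J i s := [/\ sound m c (arrs s aPar), mono s & forall u w, u < i -> done u w s].
  have [] : J n.+1 (run (PFor vU (PFor vW bfs_step)) s0).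
    have [<- _ _] := gs0; apply: run_for => //; [by split | have [-> _ _] := gs0].
    move=> u s1 un s1u fr1 [so1 mo1 do1].
    have gs1 : graph_state s1 by apply: graph_frame fr1 _ _ _ gs0.
    have ms1 : marks s1 m by apply: marks_frame fr1 _ ms0.
    pose L j s := [/\ sound m c (arrs s aPar),
      forall v, arrs s1 aPar v != 0 -> arrs s aPar v != 0 & forall w, w < j -> done u w s].
    have [] : L n.+1 (run (PFor vW bfs_step) s1).
      have [<- _ _] := gs1; apply: run_for => //; have [-> _ _] := gs1.
      move=> w s2' wn s2w fr2' [so2 mo2 do2].
      have gs2 : graph_state s2' by apply: graph_frame fr2' _ _ _ gs1.
      have ms2 : marks s2' m by apply: marks_frame fr2' _ ms1.
      have s2u : vars s2' vU = u by rewrite (proj1 fr2').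
      have := bfs_step_spec gs2 ms2; rewrite s2u s2w => /(_ c un wn so2)[so3 mo3 do3].
      split=> //= [v /mo2/mo3 //|v]; rewrite ltnS leq_eqVlt => /predU1P[->|vw].
        by move=> /mo1/mo2/do3.
      by move=> pu fuv; apply/mo3/do2.
    move=> so2 mo2 do2; split=> //= [v /mo1/mo2 //|a w].
    rewrite ltnS leq_eqVlt => /predU1P[->|au] pa faw.
      by apply: do2 => //; case/and3P: faw.
    by apply/mo2/(do1 a).
  move=> so1 mo1 do1; split=> // xs; case/lastP: xs => [_ _|xs w] /=.
    by apply: mo1; apply: (re0 [::]).
  rewrite rcons_path last_rcons size_rcons ltnS => /andP[px fw] sx.
  apply: (do1 (last c xs)) => //; last exact: re0.
  case/lastP: xs px {sx fw} => // xs y; rewrite rcons_path last_rcons.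
  by case/and4P.
move=> so re; split=> // xs px; case/shortenP: px => ys py uy _.
apply: re => //; have : size (c :: ys) <= size (iota 0 n.+1).
  apply: uniq_leq_size => // y; rewrite inE mem_iota ltnS => /predU1P[->//|].
  elim: ys (c) py {uy} => //= z ys IH c' /andP[/and3P[_ _ zn] py]; rewrite inE.
  by case/predU1P=> [->//|]; apply: IH py.
by rewrite size_iota /= => /ltnW.
Qed.

End Search.

(** * Growing a cycle by ears *)

Section Ring.

Variable T : eqType.
Implicit Types (f : T -> T) (L l : seq T).

Definition ring f L : Prop := map f L = rot 1 L.

Lemma ring_rot f i L : ring f (rot i L) <-> ring f L.
Proof.
rewrite /ring map_rot; split=> [H|->]; last by rewrite rot_rot.
by apply: (@rot_inj i); rewrite H rot_rot.
Qed.

Lemma ring_next f L c : ring f L -> uniq L -> c \in L -> f c = next L c.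
Proof.
move=> fL UL; have /eq_in_map H : map f L = map (next L) L by rewrite fL map_next.
exact: H.
Qed.

Lemma ring_head f c l : ring f (c :: l) -> f c = head c l.
Proof. by rewrite /ring rot1_cons; case: l => [|y l] /= []. Qed.

Lemma ring_insert f f' c w l :
    ring f (c :: l) -> uniq (c :: l) -> w \notin c :: l ->
    f' c = w -> f' w = f c -> (forall v, v != c -> v != w -> f' v = f v) ->
  ring f' (c :: w :: l).
Proof.
rewrite /ring !rot1_cons /= => <- /andP[cl _]; rewrite inE negb_or => /andP[_ wl] -> -> f'E.
congr [:: _, _ & _]; apply/eq_in_map => v vl; apply: f'E.
  by apply: contraNneq cl => <-.
by apply: contraNneq wl => <-.
Qed.

End Ring.

Definition search : prog :=
  PAssign vEnd (Var vC) ;;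
  PFor vW (PUnless (Get aMark (Var vW)) (PWhen (Get aPar (Var vW))
    (PWhen (edge (Var vW) (Get aNext (Var vC))) (PAssign vEnd (Var vW))))).

Definition splice_step : prog :=
  PWhen (differ (Var vEnd) (Var vC))
    (PPut aNext (Var vEnd) (Get aNext (Var vC)) ;;
     PPut aNext (Var vC) (Var vEnd) ;;
     PPut aMark (Var vEnd) (Cst 1) ;;
     PAssign vEnd (Minus (Get aPar (Var vEnd)) (Cst 1))).

Definition splice : prog := PFor vK splice_step.

Definition ear_step : prog :=
  PWhen (Minus (Get aMark (Var vC)) (Get aExcl (Var vC))) (bfs ;; search ;; splice).

Definition ears : prog :=
  PFor vW (PPut aMark (Var vW) (Get aExcl (Var vW))) ;;
  PPut aMark (Var vStart) (Cst 1) ;;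
  PPut aNext (Var vStart) (Var vStart) ;;
  PFor vRound (PFor vC ear_step).

Section Ears.

Variables (n : nat) (E : rel nat).
Implicit Types (m X : pred nat) (p f : nat -> nat) (st s : state) (xs L : seq nat).

Lemma search_spec st m (c := vars st vC) (p := arrs st aPar) (f := arrs st aNext)
    (w := vars (run search st) vEnd) :
    graph_state n E st -> marks n st m -> c <= n -> f c <= n ->
  (w = c /\ forall v, v <= n -> ~~ m v -> p v != 0 -> ~~ E v (f c)) \/
  [/\ w <= n, ~~ m w, p w != 0 & E w (f c)].
Proof.
move=> gst mst cn fcn; pose I j s :=
  (vars s vEnd = c /\ forall v, v < j -> ~~ m v -> p v != 0 -> ~~ E v (f c)) \/
  [/\ vars s vEnd <= n, ~~ m (vars s vEnd), p (vars s vEnd) != 0 & E (vars s vEnd) (f c)].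
suff : I n.+1 (run search st) by [].
rewrite /search runE; set st1 := run (PAssign _ _) st; set P := PFor _ _.
have fr1 : frame [:: 7] [::] st st1 by exact: (run_frame (PAssign vEnd (Var vC)) st).
have n1 : vars st1 0 = n by case: gst => <- _ _; rewrite (proj1 fr1).
rewrite -[X in I X.+1]n1; apply: run_for => //; first by left.
rewrite n1 => j s jn sj fr2 Is.
have fr : frame [:: 6; 7] [::] st s.
  by apply: frame_trans (frame_sub fr1 _ _) (frame_sub fr2 _ _); apply/allP.
have gs : graph_state n E s by apply: graph_frame fr _ _ _ gst.
have ms : marks n s m by apply: marks_frame fr _ mst.
have ps v : arrs s aPar v = p v by rewrite (proj2 fr).
have fs v : arrs s aNext v = f v by rewrite (proj2 fr).
have sc : vars s vC = c by rewrite (proj1 fr).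
have := @eval_edge _ _ s (Var vW) (Get aNext (Var vC)) gs.
rewrite !runE /= sj sc fs ps ms // => -> //.
have keep : (~~ m j -> p j != 0 -> ~~ E j (f c)) -> I j.+1 s.
  move=> nj; case: Is => [[sE nE]|H]; [left; split=> // v|by right].
  by rewrite ltnS leq_eqVlt => /predU1P[->|/nE].
case mj: (m j) => /=; first by apply: keep; rewrite mj.
have [pj|pj] /= := eqVneq (p j) 0; first by apply: keep; rewrite pj.
case Ej: (E j (f c)) => /=; last by apply: keep; rewrite Ej.
by right; rewrite /= mj pj Ej jn.
Qed.

Lemma splice_spec st m q xs (c := vars st vC) (p := arrs st aPar) (s := run splice st) :
    vars st 0 = n -> marks n st m -> ring (arrs st aNext) (c :: q) -> uniq (c :: q) ->
    all m (c :: q) -> path (chain n E m p) c xs -> uniq (c :: xs) -> size xs <= n.+1 ->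
    vars st vEnd = last c xs ->
  ring (arrs s aNext) (c :: xs ++ q) /\ marks n s (fun v => (v \in xs) || m v).
Proof.
move=> st0 mst rst Uq mq pxs Uxs sxs lst.
pose I k s := exists xs1 xs2, [/\ xs = xs1 ++ xs2, vars s vEnd = last c xs1,
  size xs1 = size xs - k, ring (arrs s aNext) (c :: xs2 ++ q)
  & marks n s (fun v => (v \in xs2) || m v)].
suff [xs1 [xs2 [xsE _ s1 rs ms]]] : I n.+1 s.
  have x1 : xs1 = [::] by apply/nilP; rewrite /nilp s1 subn_eq0.
  by rewrite xsE x1.
rewrite /s /splice -[in I _]st0; apply: run_for => //.
  by exists xs, [::]; rewrite cats0 subn0.
rewrite st0 => k s' kn sk fr [xs1 [xs2 [xsE se sz rs ms]]].
have sc : vars s' vC = c by rewrite (proj1 fr).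
have ps v : arrs s' aPar v = p v by rewrite (proj2 fr).
rewrite /splice_step run_if eval_differ /= se sc.
case/lastP: xs1 => [|ys w] in xsE sz se *.
  by rewrite /= eqxx; exists [::], xs2; split=> //=; rewrite subnS -sz.
rewrite last_rcons in se *.
have wxs : w \in xs by rewrite xsE mem_cat mem_rcons mem_head.
have nm v : v \in xs -> ~~ m v /\ v <= n.
  elim: (xs) (c) pxs => //= a r IH b /andP[/andP[_ /and3P[_ ma an]] pr].
  by rewrite inE => /predU1P[->|/(IH _ pr)].
have mnot v : v \in c :: q -> v \notin xs.
  by move=> /(allP mq) mv; apply/negP=> /nm[]; rewrite mv.
have wc : w != c by apply: contraTneq wxs => ->; apply: mnot; rewrite mem_head.
have [_ wn] := nm w wxs.
have wxs2 : w \notin xs2.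
  move: Uxs; rewrite xsE cat_rcons /= cat_uniq => /and4P[_ _ _ /=].
  by case/andP.
have wq : w \notin q by apply: contraL wxs => wq; apply: mnot; rewrite inE wq orbT.
have pw : p w = (last c ys).+1.
  move: pxs; rewrite xsE cat_rcons cat_path /= => /and3P[_ /andP[/eqP-> _] _].
  by [].
rewrite wc !runE /=; exists ys, (w :: xs2); split.
- by rewrite xsE cat_rcons.
- by rewrite /= se ps pw subn1.
- by move: sz; rewrite size_rcons subnS => <-.
- rewrite /= se sc; apply: (ring_insert rs).
  + have sub v : v \in xs2 -> v \in xs by rewrite xsE mem_cat orbC => ->.
    have U2 : uniq xs2 by move: Uxs; rewrite cons_uniq xsE cat_uniq => /and4P[].
    have [cq qU] : c \notin q /\ uniq q by apply/andP.
    rewrite /= mem_cat negb_or cat_uniq cq qU U2 !andbT /=.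
    apply/andP; split; first by apply: contra (mnot c (mem_head _ _)) => /sub.
    apply/hasPn=> v vq; have := mnot v; rewrite inE vq orbT => /(_ isT).
    by apply: contra; apply: sub.
  + by rewrite inE mem_cat !negb_or wc wxs2.
  + by rewrite /= eqxx.
  + by rewrite /= (negbTE wc) eqxx.
  by move=> v vc vw; rewrite /= (negbTE vc) (negbTE vw).
move=> v vn; rewrite /= se inE; case: eqP => [->|_] //=.
exact: ms.
Qed.

Definition cycle_state X st L : Prop :=
  [/\ uniq L, all (fun v => (v <= n) && ~~ X v) L, cycle (reflexive_closure E) L,
      ring (arrs st aNext) L & marks n st (fun v => (v \in L) || X v)].

Definition ear X L c xs : bool :=
  [&& xs != [::], path (free n E (fun v => (v \in L) || X v)) c xs
    & E (last c xs) (next L c)].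

Definition excluded X st : Prop := forall w, w <= n -> arrs st aExcl w = X w.

Lemma excluded_frame V A st s X : frame V A st s -> 7 \notin A -> excluded X st -> excluded X s.
Proof. by move=> [_ ars] A7 ex w wn; rewrite ars // ex. Qed.

Lemma path_free_le m c xs : path (free n E m) c xs -> all (fun v => v <= n) xs.
Proof. by elim: xs c => //= x xs IH c /andP[/and3P[_ _ ->] /IH]. Qed.

Lemma ear_step_spec st X L (c := vars st vC) (s := run ear_step st) :
    graph_state n E st -> excluded X st -> cycle_state X st L -> c <= n ->
  exists L', [/\ cycle_state X s L', {subset L <= L'}
    & size L < size L' \/ L' = L /\ (c \in L -> forall xs, ~~ ear X L c xs)].
Proof.
move=> gst ex cL cn; have [UL aL CL rL mL] := cL.
rewrite /s /ear_step run_if /= mL // ex //.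
have -> : (((c \in L) || X c) - X c != 0) = (c \in L).
  by case cL': (c \in L) => /=; [have /andP[_ /negbTE->] := allP aL c cL' | rewrite subnn].
case: ifPn => [cinL|cnL]; last by exists L; split=> //; right; split=> // cinL; rewrite cinL in cnL.
pose m v := (v \in L) || X v.
have mc : m c by rewrite /m cinL.
set st1 := run bfs st; set st2 := run search st1; set st3 := run splice st2.
have fr1 : frame [:: 4; 5; 6] [:: 6] st st1.
  by apply: frame_sub (run_frame bfs st) _ _; apply/allP.
have fr2 : frame [:: 6; 7] [::] st1 st2.
  by apply: frame_sub (run_frame search st1) _ _; apply/allP.
have fr12 : frame [:: 4; 5; 6; 7] [:: 6] st st2.
  by apply: frame_trans (frame_sub fr1 _ _) (frame_sub fr2 _ _); apply/allP.
have c1 : vars st1 vC = c by rewrite (proj1 fr1).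
have c2 : vars st2 vC = c by rewrite (proj1 fr12).
have [so re] := bfs_spec gst mL cn mc.
have gst1 : graph_state n E st1 by apply: graph_frame fr1 _ _ _ gst.
have mst1 : marks n st1 m by apply: marks_frame fr1 _ mL.
have mst2 : marks n st2 m by apply: marks_frame fr12 _ mL.
have f1 v : arrs st1 aNext v = arrs st aNext v by rewrite (proj2 fr1).
have fn : arrs st aNext c = next L c by apply: ring_next.
have fcn : next L c <= n.
  by have /andP[] := allP aL (next L c) (etrans (mem_next L c) cinL).
have p2 v : arrs st2 aPar v = arrs st1 aPar v by rewrite (proj2 fr2).
have n2 : vars st2 0 = n by rewrite (proj1 fr12) //; case: gst.
have [i q LE] := rot_to cinL.
have Lq : c :: q =i L by move=> v; rewrite -LE mem_rot.
have Uq : uniq (c :: q) by rewrite -LE rot_uniq.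
have r2 : ring (arrs st2 aNext) (c :: q).
  rewrite -LE; apply/ring_rot; rewrite /ring -rL; apply: eq_map => v.
  by rewrite (proj2 fr12).
have mq : all m (c :: q) by apply/allP=> v; rewrite Lq /m => ->.
have := @search_spec st1 m gst1 mst1; rewrite c1 f1 fn => /(_ cn fcn).
rewrite -/st2; case=> [[st2e nE]|[wn mw pw Ew]].
  exists L; split=> //; last first.
    right; split=> // _ xs; apply/negP=> /and3P[xs0 pxs lxs].
    have := re _ pxs; move: lxs; case/lastP: xs xs0 pxs => // xs w _.
    rewrite last_rcons rcons_path => /andP[_ /and3P[_ mw wn]] Ew pw.
    by have := nE w wn mw pw; rewrite Ew.
  have := @splice_spec st2 m q [::]; rewrite c2 => /(_ n2 mst2 r2 Uq mq isT isT isT st2e)[r3 m3].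
  split=> //.
  by have [+ _] := ring_rot (arrs st3 aNext) i L; apply; rewrite LE.
have [_ sp] := so; have [xs [pxs lxs uxs]] := sp _ wn pw.
have fxs : path (free n E m) c xs by apply: sub_path pxs => a b /andP[].
have pxs2 : path (chain n E m (arrs st2 aPar)) c xs.
  by apply: sub_path pxs => a b; rewrite /chain p2.
have sxs : size xs <= n.+1.
  have : size xs <= size (iota 0 n.+1).
    apply: uniq_leq_size => [|v vx]; first by case/andP: uxs.
    by rewrite mem_iota ltnS (allP (path_free_le fxs)).
  by rewrite size_iota.
have := @splice_spec st2 m q xs; rewrite c2 -/st3.
move=> /(_ n2 mst2 r2 Uq mq pxs2 uxs sxs (esym lxs)) [r3 m3].
have nm v : v \in xs -> ~~ m v.
  elim: (xs) (c) fxs => //= a r IH b /andP[/and3P[_ ma _] pr].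
  by rewrite inE => /predU1P[->|/(IH _ pr)].
have memL' v : (v \in c :: xs ++ q) = (v \in xs) || (v \in L).
  by rewrite -Lq !inE mem_cat orbCA.
exists (c :: xs ++ q); split; last 1 first.
- left; rewrite -(size_rot i) LE /= size_cat addnC ltnS -addn1 leq_add2l.
  by case: (xs) lxs mw => //= <-; rewrite mc.
- split.
  + move: Uq uxs; rewrite /= mem_cat negb_or cat_uniq => /andP[-> ->] /andP[-> ->].
    rewrite /= andbT; apply/hasPn=> v vq; apply/negP=> /nm.
    by rewrite /m -Lq inE vq orbT.
  + apply/allP=> v; rewrite memL' => /orP[vx|/(allP aL) //].
    rewrite (allP (path_free_le fxs)) //=.
    by have := nm v vx; rewrite /m negb_or => /andP[].
  + apply: cycle_splice; first by rewrite -LE rot_cycle.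
    rewrite rcons_path; apply/andP; split.
      by apply: sub_path fxs => a b /and3P[].
    by rewrite -(ring_head r2) lxs (proj2 fr12) // fn.
  + exact: r3.
  by move=> v vn; rewrite m3 // memL' orbA.
by move=> v vL; rewrite memL' vL orbT.
Qed.

Definition extendable X x0 : Prop :=
  forall L v, uniq L -> all (fun v => (v <= n) && ~~ X v) L ->
    cycle (reflexive_closure E) L -> x0 \in L -> v <= n -> ~~ ((v \in L) || X v) ->
  exists2 c, c \in L & exists xs, ear X L c xs.

Lemma ears_spec st X (x0 := vars st vStart) (s := run ears st) :
    graph_state n E st -> excluded X st -> x0 <= n -> ~~ X x0 ->
  exists L, [/\ cycle_state X s L, x0 \in L
    & extendable X x0 -> forall v, v <= n -> (v \in L) || X v].
Proof.
move=> gst ex xn Xx; rewrite /s /ears !run_seq.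
set st1 := run (PFor vW _) st; set st2 := run (PPut aMark _ _) st1.
set st3 := run (PPut aNext _ _) st2.
have fr1 : frame [:: 6] [:: 4] st st1 by exact: (run_frame (PFor vW (PPut aMark _ _)) st).
have m1 w : w <= n -> arrs st1 aMark w = X w.
  pose I j s := forall w, w < j -> arrs s aMark w = X w.
  suff H : I n.+1 st1 by apply: H.
  have n0 : vars st 0 = n by case: gst.
  rewrite -[in I _]n0; apply: run_for => //; rewrite n0 => j s' jn sj fr IH v.
  rewrite runE ltnS leq_eqVlt /= sj; case: eqP => /= [->|_ /IH //].
  by rewrite (proj2 fr) // ex.
have x1 : vars st1 vStart = x0 by rewrite (proj1 fr1).
have fr3 : frame [:: 6] [:: 4; 5] st st3.
  apply: frame_set_cell => //; apply: frame_set_cell => //.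
  by apply: frame_sub fr1 _ _; apply/allP.
have m3 : marks n st3 (fun v => (v \in [:: x0]) || X v).
  move=> v vn; rewrite inE; have -> : arrs st3 aMark v = if v == x0 then 1 else arrs st1 aMark v.
    by rewrite -x1.
  by case: eqP => //= _; apply: m1.
have f3 : arrs st3 aNext x0 = x0.
  have -> : arrs st3 aNext x0 =
    if x0 == vars st1 vStart then vars st1 vStart else arrs st1 aNext x0 by [].
  by rewrite x1 eqxx.
have gst3 : graph_state n E st3 by apply: graph_frame fr3 _ _ _ gst.
have ex3 : excluded X st3 by apply: excluded_frame fr3 _ ex.
clearbody st3; clear st1 st2 fr1 m1 x1 fr3.
pose covers L := extendable X x0 -> forall v, v <= n -> (v \in L) || X v.
have coversS L L' : {subset L <= L'} -> covers L -> covers L'.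
  by move=> sub cov exd v vn; have /orP[/sub->//|->] := cov exd v vn; rewrite orbT.
pose I r s := exists L, [/\ cycle_state X s L, x0 \in L & r <= size L \/ covers L].
have [L [cL xL sL]] : I n.+1 (run (PFor vRound (PFor vC ear_step)) st3).
  have n3 : vars st3 0 = n by case: gst3.
  rewrite -[in I _]n3; apply: run_for => //.
    exists [:: x0]; split; [split=> //=|by rewrite mem_head|by left].
    - by rewrite xn Xx.
    - by rewrite /reflexive_closure /= eqxx.
    by rewrite /ring /= f3.
  rewrite n3 => r s0 rn sr fr0 [L0 [cL0 xL0 rL0]].
  have gs0 : graph_state n E s0 by apply: graph_frame fr0 _ _ _ gst3.
  have ex0 : excluded X s0 by apply: excluded_frame fr0 _ ex3.
  pose J c s := exists L, [/\ cycle_state X s L, x0 \in L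
    & [\/ r < size L, covers L | r <= size L /\
       forall c', c' < c -> c' \in L -> forall xs, ~~ ear X L c' xs]].
  have [L [cL xL HL]] : J n.+1 (run (PFor vC ear_step) s0).
    have n0 : vars s0 0 = n by case: gs0.
    rewrite -[in J _]n0; apply: run_for => //.
      exists L0; split=> //; case: rL0 => rL0; [constructor 3|constructor 2] => //.
    rewrite n0 => c s1 cn sc fr1 [L1 [cL1 xL1 HL1]].
    have gs1 : graph_state n E s1 by apply: graph_frame fr1 _ _ _ gs0.
    have ex1 : excluded X s1 by apply: excluded_frame fr1 _ ex0.
    have := @ear_step_spec s1 X L1 gs1 ex1 cL1; rewrite sc => /(_ cn)[L2 [cL2 sub HL2]].
    exists L2; split=> //; first exact: sub.
    have [UL1 _ _ _ _] := cL1; have le12 := uniq_leq_size UL1 sub.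
    case: HL1 => [lt1|cov1|[le1 no1]].
    - by constructor 1; apply: leq_trans le12.
    - by constructor 2; apply: coversS cov1.
    case: HL2 => [lt2|[-> noc]]; first by constructor 1; apply: leq_ltn_trans lt2.
    constructor 3; split=> // c'; rewrite ltnS leq_eqVlt => /predU1P[->|/no1 //].
    exact: noc.
  exists L; split=> //; case: HL => [|cov|[_ no]]; [by left|by right|right].
  move=> exd v vn; apply/negPn/negP=> vN; have [UL aL CL _ _] := cL.
  have [c cinL [xs ears_c]] := exd L v UL aL CL xL vn vN.
  have /andP[cn _] := allP aL c cinL.
  by have := no c cn cinL xs; rewrite ears_c.
exists L; split=> //; case: sL => // sL _ v vn.
have [UL aL _ _ _] := cL.
have sub : {subset L <= iota 0 n.+1}.
  by move=> y /(allP aL)/andP[yn _]; rewrite mem_iota ltnS.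
have [|_ ->] := uniq_min_size UL sub; first by rewrite size_iota.
by rewrite mem_iota ltnS vn.
Qed.

End Ears.

(** * Input, output and the auxiliary vertex *)

Lemma ring_iter (T : eqType) (f : T -> T) (x0 x : T) q i :
  ring f (x :: q) -> i <= size q -> iter i f x = nth x0 (x :: q) i.
Proof.
rewrite /ring rot1_cons => fE; elim: i => //= i IH iq; rewrite IH 1?ltnW //.
by rewrite -(nth_map x0 x0 f) ?fE ?nth_rcons ?iq //= ltnS ltnW.
Qed.

Lemma divn_decomposition_uniq N u w i j :
  w < N -> j < N -> u * N + w = i * N + j -> u = i /\ w = j.
Proof.
move=> wN jN H; have N0 : 0 < N by apply: leq_ltn_trans wN.
have := congr1 (fun k => k %/ N) H; have := congr1 (fun k => k %% N) H.
by rewrite !modnMDl !modn_small // !divnMDl // !divn_small // !addn0.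
Qed.

(* Vertices beyond n.-1 are adjacent to everything in both directions: vertex n turns
   Hamilton paths of e into Hamilton cycles through n. *)
Definition star n (e : rel 'I_n) : rel nat := fun u w =>
  match insub u, insub w with Some i, Some j => e i j | _, _ => true end.

Definition setup : prog :=
  PFor vU (PPut aMul (Var vU) (Var vAcc) ;;
           PAssign vAcc (Add (Var vAcc) (Add (Var vN) (Cst 1)))) ;;
  PFor vU (PFor vW
    (PIf (Minus (Var vN) (Var vU))
       (PIf (Minus (Var vN) (Var vW))
          (PPut aAdj (Add (Get aMul (Var vU)) (Var vW))
                (Get aIn (Minus (Add (Get aMul (Var vU)) (Var vW)) (Var vU))))
          (PPut aAdj (Add (Get aMul (Var vU)) (Var vW)) (Cst 1)))
       (PPut aAdj (Add (Get aMul (Var vU)) (Var vW)) (Cst 1)))).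

Definition walk (a : nat) : prog :=
  PFor vU (PPut a (Var vU) (Var vCur) ;; PAssign vCur (Get aNext (Var vCur))).

Definition check : prog :=
  PAssign vDone (Cst 1) ;;
  PFor vW (PUnless (Get aMark (Var vW)) (PAssign vDone (Cst 0))).

Definition tail : prog :=
  PFor vU (PWhen (Minus (Var vQ) (Var vU))
    (PPut aOut (Minus (Minus (Var vN) (Cst 1)) (Var vU)) (Get aQ (Var vU)))).

Lemma star_ord n (e : rel 'I_n) (i j : 'I_n) : star e (val i) (val j) = e i j.
Proof. by rewrite /star !valK. Qed.

Lemma star_l n (e : rel 'I_n) w : star e n w.
Proof. by rewrite /star insubF // ltnn. Qed.

Lemma star_r n (e : rel 'I_n) u : star e u n.
Proof. by rewrite /star [insub n]insubF ?ltnn //; case: insub. Qed.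

Lemma input_stateE n (e : rel 'I_n) u w : u < n -> w < n ->
  arrs (input_state e) aIn (u * n + w) = star e u w.
Proof.
move=> un wn; rewrite /star (insubT (fun k => k < n) un) (insubT (fun k => k < n) wn) /=.
congr nat_of_bool; apply/existsP/idP => [[i /existsP[j /andP[/eqP H eij]]]|eij].
  have [ui wj] := divn_decomposition_uniq wn (ltn_ord j) H.
  by congr (is_true (e _ _)): eij; apply: val_inj.
by exists (Ordinal un); apply/existsP; exists (Ordinal wn); rewrite eqxx.
Qed.

Lemma setup_spec n (e : rel 'I_n) (s := run setup (input_state e)) :
  [/\ graph_state n (star e) s & forall i, arrs s aExcl i = 0].
Proof.
have frs : frame [:: 5; 6; 8] [:: 2; 3] (input_state e) s.
  by apply: frame_sub (run_frame setup _) _ _; apply/allP.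
split=> [|i]; last by rewrite (proj2 frs).
rewrite /s /setup run_seq; set st1 := run _ (input_state e).
have fr1 : frame [:: 5; 8] [:: 3] (input_state e) st1.
  by apply: frame_sub (run_frame (PFor vU (PPut aMul _ _ ;; PAssign vAcc _)) _) _ _; apply/allP.
have n1 : vars st1 0 = n by rewrite (proj1 fr1).
have mul1 u : u <= n -> arrs st1 aMul u = u * n.+1.
  pose I i s := vars s vAcc = i * n.+1 /\ forall u, u < i -> arrs s aMul u = u * n.+1.
  suff [_ H] : I n.+1 st1 by apply: H.
  apply: (run_for (st := input_state e)) => // i s' il si fr [accE mulE].
  rewrite !runE /=; split=> /= [|v].
    by rewrite accE (proj1 fr) //= addn1 mulSn addnC.
  rewrite ltnS leq_eqVlt accE si; case: eqP => [->|] //= _; exact: mulE.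
have in1 u w : u < n -> w < n -> arrs st1 aIn (u * n + w) = star e u w.
  by move=> un wn; rewrite (proj2 fr1) // input_stateE.
clearbody st1; clear fr1 frs; set P := PFor _ _.
have fr2 : frame [:: 5; 6] [:: 2] st1 (run P st1).
  by apply: frame_sub (run_frame P _) _ _; apply/allP.
split=> [|u un|]; [by rewrite (proj1 fr2)|by rewrite (proj2 fr2) // mul1|].
pose I i s := forall u w, u < i -> w <= n -> arrs s aAdj (u * n.+1 + w) = star e u w.
suff H : I n.+1 (run P st1) by move=> u w un wn; apply: H.
rewrite -[in I _]n1; apply: run_for => //; rewrite n1 => i s1 il si fr3 IH.
pose J j s := forall u w, (u < i) && (w <= n) || (u == i) && (w < j) ->
  arrs s aAdj (u * n.+1 + w) = star e u w.
set P' := PFor _ _; suff H : J n.+1 (run P' s1).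
  move=> u w ui wn; apply: H; rewrite ltnS wn !andbT orbC -leq_eqVlt.
  by rewrite -ltnS.
have n3 : vars s1 0 = n by rewrite (proj1 fr3).
rewrite -[in J _]n3; apply: run_for => //.
  by move=> u w; rewrite andbF orbF => /andP[ui wn]; apply: IH.
rewrite n3 => j s2 jl sj fr4 IHJ.
have nE : vars s2 0 = n by rewrite (proj1 fr4).
have s2i : vars s2 5 = i by rewrite (proj1 fr4).
have mE : arrs s2 aMul i = i * n.+1 by rewrite (proj2 fr4) // (proj2 fr3) // mul1.
have aE k : arrs s2 aIn k = arrs st1 aIn k by rewrite (proj2 fr4) // (proj2 fr3).
suff step s3 : (forall k, arrs s3 aAdj k =
    if k == i * n.+1 + j then (star e i j : nat) else arrs s2 aAdj k) -> J j.+1 s3.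
  have T k : (n - k != 0) = (k < n) by rewrite subn_eq0 -ltnNge.
  apply: step => k; rewrite !runE /= nE s2i sj !T.
  case: (ltnP i n) => iN; last first.
    have iE : i = n by apply/eqP; rewrite eqn_leq il iN.
    by rewrite /= ?s2i ?sj mE iE star_l.
  case: (ltnP j n) => jN; last first.
    have jE : j = n by apply/eqP; rewrite eqn_leq jl jN.
    by rewrite /= ?s2i ?sj mE jE star_r.
  rewrite /= ?s2i ?sj mE aE.
  have -> : i * n.+1 + j - i = i * n + j by rewrite mulnS -addnA addKn.
  by rewrite in1.
move=> s3E u w H; rewrite s3E; case: eqP => [Euw|neq].
  have wn : w < n.+1 by move: H; case/orP=> /andP[] //; lia.
  by have [-> ->] := divn_decomposition_uniq wn (jl : j < n.+1) Euw.
apply: IHJ; case/orP: H => [->//|/andP[/eqP ui]]; rewrite ltnS leq_eqVlt => /predU1P[wj|->].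
  by rewrite ui wj in neq.
by rewrite ui eqxx orbT.
Qed.

Lemma walk_spec n a st : vars st 0 = n -> a != 5 ->
  forall i, i <= n -> arrs (run (walk a) st) a i = iter i (arrs st aNext) (vars st vCur).
Proof.
move=> st0 a5; set f := arrs st aNext; set x := vars st vCur.
pose I k s := vars s vCur = iter k f x /\ forall i, i < k -> arrs s a i = iter i f x.
suff [_ H] : I n.+1 (run (walk a) st) by move=> i il; apply: H.
rewrite -[in I _]st0; apply: run_for => //; rewrite st0 => k s kn sk fr [cE aE].
rewrite !runE; split=> /= [|i].
  by rewrite eq_sym (negbTE a5) /= (proj2 fr) ?inE 1?eq_sym // cE.
by rewrite ltnS leq_eqVlt eqxx sk cE; case: eqP => /= [->|_ /aE].
Qed.

Lemma check_spec n m st : vars st 0 = n -> marks n st m ->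
  vars (run check st) vDone = all m (iota 0 n.+1).
Proof.
move=> st0 ms; pose I j s := vars s vDone = all m (iota 0 j).
rewrite -/(I n.+1 (run check st)) /check run_seq; set st1 := run (PAssign _ _) st.
have fr1 : frame [:: 11] [::] st st1 by exact: (run_frame (PAssign vDone (Cst 1)) st).
have n1 : vars st1 0 = n by rewrite (proj1 fr1).
rewrite -[in I _]n1; apply: run_for => //; rewrite n1 => j s jn sj fr Is.
rewrite /I -[j.+1]addn1 iotaD all_cat /= andbT add0n runE /= sj (proj2 fr) // (proj2 fr1) // ms //.
by case: (m j); rewrite runE /= ?andbT ?andbF.
Qed.

Lemma tail_spec n st (q := vars st vQ) : vars st 0 = n -> q <= n ->
  forall i, i < n -> arrs (run tail st) aOut i =
    if n.-1 - i < q then arrs st aQ (n.-1 - i) else arrs st aOut i.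
Proof.
move=> st0 qn; pose I j s := forall i, i < n -> arrs s aOut i =
  if (n.-1 - i < j) && (n.-1 - i < q) then arrs st aQ (n.-1 - i) else arrs st aOut i.
suff H : I n.+1 (run tail st).
  by move=> i il; rewrite H //; have -> : n.-1 - i < n.+1 by lia.
rewrite -[in I _]st0; apply: run_for => //; rewrite st0 => j s jn sj fr Is i il.
rewrite runE /= sj (proj1 fr) // -/q ltnS leq_eqVlt.
have [qj|jq] := leqP q j.
  have -> : q - j = 0 by lia.
  rewrite runE /= Is //; case: eqP => //= ->.
  by rewrite ltnn ltnNge qj.
have -> /= : q - j != 0 by lia.
rewrite ?runE /= sj (proj1 fr) // st0 (proj2 fr) // subn1 Is //.
have [iE|iN] := eqVneq i (n.-1 - j).
  have -> : n.-1 - i = j by lia.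
  by rewrite eqxx jq.
by case: eqP => // /eqP H; lia.
Qed.

(** * The greedy path, computed *)

Lemma sorted_index_connect (T : finType) (r : rel T) L a b :
  sorted r L -> uniq L -> b \in L -> index a L <= index b L -> connect r a b.
Proof.
move=> sL UL bL leab; have aL : a \in L.
  by rewrite -index_mem; apply: leq_ltn_trans leab _; rewrite index_mem.
case/splitPr: aL sL UL bL leab => l1 l2 sL UL; rewrite mem_cat => /orP[bl|bl].
  have al : a \notin l1.
    by move: UL; rewrite cat_uniq => /and3P[_ + _] => /= /norP[].
  rewrite !index_cat bl (negbTE al) /= eqxx addn0 => le; move: bl.
  by rewrite -index_mem ltnNge le.
move=> _; have /cat_sorted2[_ pl] := sL.
exact: (path_connect (pl : path r a l2) bl).
Qed.

Definition greedy_step : prog :=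
  PUnless (Var vDone)
    (PAssign vBest (Cst 0) ;;
     PFor vU (PWhen (Minus (Var vN) (Var vU))
       (PWhen (edge (Var vCur) (Get aPath (Var vU))) (PAssign vBest (Var vU)))) ;;
     PIf (Minus (Minus (Var vN) (Cst 1)) (Var vBest))
       (PAssign vCur (Get aPath (Var vBest)) ;;
        PPut aQ (Var vQ) (Var vCur) ;;
        PPut aExcl (Var vCur) (Cst 1) ;;
        PAssign vQ (Add (Var vQ) (Cst 1)))
       (PAssign vDone (Cst 1))).

Definition greedy : prog :=
  PAssign vCur (Get aPath (Cst 0)) ;;
  PAssign vQ (Cst 0) ;;
  PAssign vDone (Cst 0) ;;
  PFor vRound greedy_step.

Section GreedyProgram.

Variables (n : nat) (e : rel 'I_n) (h : 'I_n) (p : seq 'I_n).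
Hypotheses (lsd : locally_semicomplete e) (path_p : path e h p) (uniq_p : uniq (h :: p)).
Hypothesis p_all : forall v, v \in h :: p.
Let t := last h p.
Let H := h :: p.
Hypothesis not_strong : ~~ connect e t h.

Let size_H : size H = n.
Proof.
by rewrite -[RHS]card_ord /H -(card_uniqP uniq_p); apply: eq_card => v; rewrite p_all.
Qed.

Let index_lt v : index v H < n.
Proof. by rewrite -[n in _ < n]size_H index_mem p_all. Qed.

Let n_gt0 : 0 < n. Proof. by rewrite -size_H. Qed.

Let index_t : index t H = n.-1.
Proof.
by rewrite -[t]/(last h H) -nth_last index_uniq // size_H.
Qed.

Let connect_index a b : index a H <= index b H -> connect e a b.
Proof. by apply: sorted_index_connect => //; apply: p_all. Qed.

Let source v : connect e h v.
Proof. by apply: connect_index; rewrite /H /= eqxx. Qed.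

Let sink v : connect e v t.
Proof. by apply: connect_index; rewrite index_t -ltnS prednK. Qed.

Definition path_stored st : Prop := forall i, i < n -> arrs st aPath i = val (nth h H i).

Lemma greedy_step_spec st X (x := last h X) (s := run greedy_step st) :
    graph_state n (star e) st -> path_stored st -> vars st vDone = 0 ->
    vars st vCur = val x -> ~~ connect e t x ->
  (vars s vDone <> 0 /\ farthest e x t /\ vars s vQ = vars st vQ /\
   (forall i, arrs s aQ i = arrs st aQ i) /\ (forall i, arrs s aExcl i = arrs st aExcl i)) \/
  exists y, [/\ farthest e x y, ~~ connect e t y & index x H < index y H] /\
    [/\ vars s vDone = 0, vars s vCur = val y, vars s vQ = (vars st vQ).+1,
      forall i, arrs s aQ i = if i == vars st vQ then val y else arrs st aQ i
    & forall i, arrs s aExcl i = if i == val y then 1 else arrs st aExcl i].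
Proof.
move=> gst pst d0 cx tx.
rewrite /s /greedy_step run_if /= d0 /= !run_seq.
set st1 := run _ st; set P := PFor _ _; set st2 := run P st1.
have fr1 : frame [:: 12] [::] st st1 by exact: (run_frame (PAssign vBest (Cst 0)) st).
have fr2 : frame [:: 5; 12] [::] st st2.
  by apply: frame_trans (frame_sub fr1 _ _) (frame_sub (run_frame P st1) _ _); apply/allP.
have n1 : vars st1 0 = n by rewrite (proj1 fr1) //; case: gst.
have n2 : vars st2 0 = n by rewrite (proj1 fr2) //; case: gst.
pose ex i := (i < n) && e x (nth h H i).
pose I j s := (vars s vBest = 0 \/ ex (vars s vBest)) /\
  forall i, i < j -> ex i -> i <= vars s vBest.
have [best_ex best_max] : I n.+1 st2.
  rewrite -[in I _]n1; apply: run_for => //; first by split=> //; left.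
  rewrite n1 => j s' jn sj fr [be bm].
  have fr' : frame [:: 5; 12] [::] st s'.
    by apply: frame_trans (frame_sub fr1 _ _) fr; apply/allP.
  have gs' : graph_state n (star e) s' by apply: graph_frame fr' _ _ _ gst.
  rewrite run_if /= sj (proj1 fr') //; have -> : vars st 0 = n by case: gst.
  have [jlt|jge] := ltnP j n; last first.
    have -> : n - j = 0 by apply/eqP; rewrite subn_eq0.
    split=> //= i; rewrite ltnS leq_eqVlt => /predU1P[->|/bm //].
    by rewrite /ex ltnNge jge.
  rewrite -lt0n subn_gt0 jlt run_if.
  have pj : arrs s' aPath j = val (nth h H j) by rewrite (proj2 fr') // pst.
  have -> : eval s' (edge (Var vCur) (Get aPath (Var vU))) = e x (nth h H j).
    rewrite (eval_edge gs') /= ?sj ?pj ?(proj1 fr') ?cx ?star_ord //; apply: ltnW; apply: ltn_ord.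
  case exj: (e x (nth h H j)) => /=.
    split=> /=; first by right; rewrite /ex sj jlt exj.
    by move=> i; rewrite ltnS sj.
  split=> // i; rewrite ltnS leq_eqVlt => /predU1P[->|/bm //].
  by rewrite /ex exj andbF.
clearbody st2; pose b := vars st2 vBest.
have [z exz zx] := exit_arc lsd (sink x) tx.
have lt_z : index x H < index z H.
  by rewrite ltnNge; apply: contra zx; apply: connect_index.
have exI v : e x v -> index v H <= b.
  move=> xv; apply: best_max; first exact: leq_trans (index_lt v) _.
  by rewrite /ex index_lt nth_index // p_all.
have bz := exI z exz.
have exb : ex b.
  by case: best_ex => // b0; have := leq_trans lt_z bz; rewrite /b b0.
have /andP[b_lt xb] := exb.
have ib : index (nth h H b) H = b by rewrite index_uniq ?size_H.
have far : farthest e x (nth h H b).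
  rewrite /farthest /= xb; apply/forall_inP=> v /exI xv.
  by apply: connect_index; rewrite ib.
rewrite run_if /= n2 -/b.
have [bl|bl] := eqVneq b n.-1.
  left; rewrite bl subn1 subnn /=; split=> //; split; last first.
    by split; [rewrite ?runE /= (proj1 fr2)|split=> i; rewrite (proj2 fr2)].
  by have -> : t = nth h H b; rewrite // bl -index_t nth_index ?p_all.
right; exists (nth h H b); split.
  split=> //; last by rewrite -[X in _ < X]/(index (nth h H b) H) ib; apply: leq_trans bz.
  apply/negP=> tb; have := dom_in lsd xb tb tx => /exI.
  rewrite index_t => le; move: bl; rewrite eqn_leq le andbT => /negP[].
  by rewrite -ltnS prednK.
have -> : n - 1 - b != 0.
  by rewrite subn1 subn_eq0 -ltnNge ltn_neqAle bl -ltnS prednK.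
have pb : arrs st2 aPath b = val (nth h H b) by rewrite (proj2 fr2) // pst.
have q2 : vars st2 vQ = vars st vQ by rewrite (proj1 fr2).
rewrite !runE /= -/b pb q2; split=> //.
- by rewrite (proj1 fr2).
- by rewrite addn1.
- by move=> i; rewrite (proj2 fr2).
by move=> i; rewrite (proj2 fr2).
Qed.

Lemma greedy_spec st (s := run greedy st) :
    graph_state n (star e) st -> path_stored st -> excluded n pred0 st ->
  exists X, [/\ greedy_path e h t X, excluded n (fun v => v \in map val X) s,
    vars s vQ = size X & forall j, j < size X -> arrs s aQ j = val (nth h X j)].
Proof.
move=> gst pst ex; rewrite /s /greedy !run_seq.
set st1 := run (PAssign vCur _) st; set st2 := run (PAssign vQ _) st1.
set st3 := run (PAssign vDone _) st2.
have fr3 : frame [:: 9; 10; 11] [::] st st3.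
  apply: frame_sub (run_frame (PAssign vCur _ ;; PAssign vQ _ ;; PAssign vDone _) st) _ _;
    exact/allP.
have gst3 : graph_state n (star e) st3 by apply: graph_frame fr3 _ _ _ gst.
have pst3 : path_stored st3 by move=> i il; rewrite (proj2 fr3) // pst.
have ex3 : excluded n pred0 st3 by apply: excluded_frame fr3 _ ex.
have q3 : vars st3 vQ = 0 by [].
have d3 : vars st3 vDone = 0 by [].
have c3 : vars st3 vCur = val h by rewrite -[RHS]/(val (nth h H 0)) -pst.
have n3 : vars st3 0 = n by case: gst3.
clearbody st3; clear st1 st2 fr3.
pose I r s := exists X, [/\ path (farthest e) h X, all (fun x => ~~ connect e t x) (h :: X),
   excluded n (fun v => v \in map val X) s, vars s vQ = size X
  & forall j, j < size X -> arrs s aQ j = val (nth h X j)] /\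
  ((vars s vDone = 0 /\ vars s vCur = val (last h X) /\ r <= index (last h X) H) \/
   (vars s vDone <> 0 /\ farthest e (last h X) t)).
have [X [[pX aX eX qX QX] fin]] : I n.+1 (run (PFor vRound greedy_step) st3).
  rewrite -[in I _]n3; apply: run_for => //.
    by exists [::]; split; [split=> //=; rewrite not_strong|left].
  rewrite n3 => r s1 rn sr fr [X [[pX aX eX qX QX]]].
  have gs1 : graph_state n (star e) s1 by apply: graph_frame fr _ _ _ gst3.
  have ps1 : path_stored s1 by move=> i il; rewrite (proj2 fr) // pst3.
  case=> [[d0 [cX rX]]|[d1 fX]]; last first.
    exists X; have -> : run greedy_step s1 = s1.
      by rewrite /greedy_step run_if /=; case: eqP.
    by split; [split|right].
  have tx : ~~ connect e t (last h X) by apply: (allP aX); apply: mem_last.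
  have [[d1 [fX [q1 [Q1 e1]]]]|[y [[fy ty iy] [d1 c1 q1 Q1 e1]]]] :=
      greedy_step_spec gs1 ps1 d0 cX tx.
    exists X; split; [split=> //= [v vn||j jX]|by right].
    - by rewrite e1 eX.
    - by rewrite q1.
    by rewrite Q1 QX.
  exists (rcons X y); rewrite last_rcons rcons_path pX fy; split; last first.
    by left; split=> //; split=> //; apply: leq_ltn_trans iy.
  split=> //=.
  - by move: aX; rewrite /= all_rcons ty => /andP[-> ->].
  - move=> v vn; rewrite e1 map_rcons mem_rcons inE.
    by case: eqP => //= _; apply: eX.
  - by rewrite q1 qX size_rcons.
  move=> j; rewrite size_rcons ltnS nth_rcons Q1 qX => jX.
  by case: ltngtP jX => // jX _; apply: QX.
exists X; split=> //; case: fin => [[_ [_ le]]|[_ fX]].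
  by have := index_lt (last h X); rewrite ltnNge (leq_trans _ le).
by split=> //; rewrite rcons_path pX.
Qed.

End GreedyProgram.

(** * The algorithm *)

Lemma map_val_ord n (L : seq nat) :
  all (fun v => v < n) L -> exists L' : seq 'I_n, L = map val L'.
Proof.
elim: L => [|v L IH] /=; first by exists [::].
by case/andP=> vn /IH[L' ->]; exists (Ordinal vn :: L').
Qed.

Lemma path_free_map n (e : rel 'I_n) (m : pred nat) (x : 'I_n) p :
    path e x p -> all (fun v => ~~ m (val v)) p ->
  path (free n (star e) m) (val x) (map val p).
Proof.
elim: p x => //= y p IH x /andP[exy py] /andP[my mp].
by rewrite /free star_ord exy my IH // ltnW ?ltn_ord.
Qed.

Lemma cycle_star n (e : rel 'I_n) L :
  cycle (reflexive_closure (star e)) (map val L) = cycle (reflexive_closure e) L.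
Proof.
by rewrite cycle_map; apply: eq_cycle => x y; rewrite /reflexive_closure /= star_ord.
Qed.

Lemma next_middle (T : eqType) (x : T) l1 l2 :
  uniq (x :: l1 ++ l2) -> next (x :: l1 ++ l2) (last x l1) = head x l2.
Proof.
rewrite -cat_cons lastI cat_rcons => U; rewrite -(next_rot (size (belast x l1))) //.
rewrite rot_size_cat; case: l2 U => [|y l2] U /=; last by rewrite eqxx.
by case: l1 U => [|z l1] U /=; rewrite eqxx.
Qed.

Section Extendable.

Variables (n : nat) (e : rel 'I_n).
Hypothesis lsd : locally_semicomplete e.

Lemma extendable_strong : strong e -> extendable n (star e) (pred1 n) 0.
Proof.
move=> eS L v UL aL cL L0 vn; rewrite negb_or => /andP[vL /= vNn].
have [|L' LE] := @map_val_ord n L.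
  by apply: sub_all aL => u /=; case/andP=> un uN; rewrite ltn_neqAle uN.
have v_lt : v < n by rewrite ltn_neqAle vNn.
rewrite LE in UL L0 vL cL *; rewrite cycle_star in cL.
have {}UL : uniq L' by rewrite -(map_inj_uniq val_inj).
have /mapP[c0 c0L _] := L0.
have vL' : Ordinal v_lt \notin L'.
  by apply: contra vL => /(map_f val).
have [c [xs [cL' xs0 xsL pxs]]] := strong_ear lsd eS UL cL c0L vL'.
exists (val c); first exact: map_f.
move: pxs; rewrite rcons_path => /andP[pxs ec].
exists (map val xs); rewrite /ear last_map next_map //; last exact: val_inj.
rewrite star_ord ec andbT -size_eq0 size_map size_eq0 xs0 /=.
apply: path_free_map => //; apply: sub_all xsL => u /= uL.
by rewrite (mem_map val_inj) negb_or uL neq_ltn ltn_ord.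
Qed.

Lemma star_cycle_path (X : pred nat) L :
    uniq L -> all (fun v => (v <= n) && ~~ X v) L ->
    cycle (reflexive_closure (star e)) L -> n \in L ->
  exists i l, [/\ rot i L = n :: map val l, uniq l, sorted e l
                & all (fun v => ~~ X (val v)) l].
Proof.
move=> UL aL cL nL; have [i q LE] := rot_to nL.
move: UL cL; rewrite -(rot_uniq i) -(rot_cycle i) LE => UL cL.
have {}aL : all (fun v => (v <= n) && ~~ X v) (n :: q).
  by apply/allP=> u; rewrite -LE mem_rot => /(allP aL).
have /andP[nq Uq] : (n \notin q) && uniq q by [].
have [|l lE] := @map_val_ord n q.
  apply/allP=> u uq; have /andP[un _] := allP aL u (mem_behead (s := n :: q) uq).
  by rewrite ltn_neqAle un andbT; apply: contraNneq nq => <-.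
exists i, l; rewrite LE lE; split=> //.
- by rewrite -(map_inj_uniq val_inj) -lE.
- case: l lE => // x l lE; rewrite lE in UL cL.
  have := cycle_irreflexive UL isT cL; rewrite /= rcons_path => /and3P[_ + _].
  by rewrite path_map; apply: sub_path => a b; rewrite /= star_ord.
by move: aL; rewrite lE /= all_map => /andP[_]; apply: sub_all => u /andP[].
Qed.

Lemma extendable_path (X : seq 'I_n) : connected_on e (~: [set x in X]) ->
  extendable n (star e) (fun v => v \in map val X) n.
Proof.
move=> cA L v UL aL cL nL vn; rewrite negb_or => /andP[vL vX].
have [i [l [LE Ul sl al]]] := star_cycle_path UL aL cL nL.
have v_lt : v < n by rewrite ltn_neqAle vn andbT; apply: contraNneq vL => ->.
have nextE c : next L c = next (n :: map val l) c by rewrite -LE next_rot.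
have memL u : (u \in L) = (u == n) || (u \in map val l) by rewrite -(mem_rot i) LE.
have [l0|l0] := eqVneq l [::].
  exists n => //; exists [:: v].
  by rewrite /ear nextE l0 /= eqxx /free star_l star_r vn (negbTE vL) vX.
have [c0 c0l] : exists c, c \in l by case: (l) l0 => // c s _; exists c; rewrite mem_head.
have vl : Ordinal v_lt \notin l.
  by move: vL; rewrite memL negb_or => /andP[_]; apply: contra => /(map_f val).
have vA : Ordinal v_lt \in ~: [set x in X].
  by rewrite !inE; apply: contra vX => /(map_f val).
have lA : {subset l <= ~: [set x in X]}.
  by move=> u /(allP al); rewrite (mem_map val_inj) !inE.
have [w [l1 [l2 [wA wl lE sw]]]] := extend_path lsd cA sl lA c0l vA vl.
have U : uniq (n :: map val l1 ++ map val l2) by rewrite -map_cat -lE -LE rot_uniq.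
exists (last n (map val l1)).
  rewrite memL lE map_cat mem_cat orbA -in_cons mem_last //.
exists [:: val w]; rewrite /ear nextE lE map_cat next_middle //=.
rewrite /free (ltnW (ltn_ord w)) memL (mem_map val_inj) (negbTE wl) orbF (mem_map val_inj).
have wX : w \notin X by rewrite !inE in wA.
rewrite (negbTE wX) orbF neq_ltn ltn_ord !andbT /=.
apply/andP; split.
  case: l1 sw {lE U} => [|a l1] /=; first by rewrite star_l.
  by rewrite last_map star_ord cat_path /= => /and3P[].
case: l2 sw {lE U} => [|y l2] /=; first by rewrite star_r.
by rewrite star_ord => /cat_sorted2[_ /= /andP[]].
Qed.

End Extendable.

(* When vStart holds n, the vertices following n on the cycle found by ears form a Hamilton
   path of the digraph induced by the vertices that are not excluded. *)
Definition path_prog (a : nat) : prog :=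
  ears ;; PAssign vCur (Get aNext (Var vN)) ;; walk a.

Definition nonstrong_prog : prog :=
  path_prog aPath ;; greedy ;; path_prog aOut ;; tail.

Definition hamilton_prog : prog :=
  setup ;;
  PPut aExcl (Var vN) (Cst 1) ;;
  ears ;;
  check ;;
  PIf (Var vDone)
    (PAssign vCur (Cst 0) ;; walk aOut)
    (PPut aExcl (Var vN) (Cst 0) ;; PAssign vStart (Var vN) ;; nonstrong_prog).

Lemma suffix_index a b n i : a + b = n -> i < n -> (n.-1 - i < b) = (a <= i).
Proof. lia. Qed.

Lemma rev_suffix_index a b n i :
  a + b = n -> a <= i -> i < n -> i - a < b /\ b - (i - a).+1 = n.-1 - i.
Proof. lia. Qed.

Section Correctness.

Variables (n : nat) (e : rel 'I_n).
Hypotheses (lsd : locally_semicomplete e) (conn : connected e) (n3 : 3 <= n).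

Lemma path_prog_spec (X : seq 'I_n) a st (s := run (path_prog a) st) :
    a != 5 -> connected_on e (~: [set x in X]) -> graph_state n (star e) st ->
    excluded n (fun v => v \in map val X) st -> vars st vStart = n ->
  exists l, [/\ uniq l, sorted e l, l =i [predC X]
    & forall i, i < size l -> arrs s a i = nth n (map val l) i].
Proof.
move=> a5 cA gst ex st1; have nX : n \notin map val X.
  by apply/mapP => -[x _ nx]; have := ltn_ord x; rewrite -nx ltnn.
rewrite /s /path_prog 2!run_seq; set s1 := run ears st.
have n1 : vars s1 0 = n by rewrite (proj1 (run_frame ears st)) //; case: gst.
have := @ears_spec n (star e) st _ gst ex; rewrite st1 -/s1 => /(_ (leqnn n) nX).
case=> L [[UL aL cL rL _] nL cov]; clearbody s1.
have [i [l [LE Ul sl al]]] := star_cycle_path UL aL cL nL.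
have lX v : (v \in l) = (v \notin X).
  apply/idP/idP => [/(allP al)|vX]; first by rewrite (mem_map val_inj).
  have := cov (extendable_path lsd cA) (val v) (ltnW (ltn_ord v)).
  rewrite (mem_map val_inj) (negbTE vX) orbF -(mem_rot i L) LE inE (mem_map val_inj).
  by case: eqP => //= vn; have := ltn_ord v; rewrite [X in X < _]vn ltnn.
exists l; split=> // j jl; have rE : ring (arrs s1 aNext) (n :: map val l).
  by have [_ +] := ring_rot (arrs s1 aNext) i L; rewrite LE; apply.
have szl : size l <= n.
  by rewrite -[n in _ <= n]card_ord -(card_uniqP Ul) max_card.
rewrite (walk_spec (n := n)) //; last exact: leq_trans (ltnW jl) szl.
have := ring_iter n rE (i := j.+1); rewrite size_map => /(_ jl).
by rewrite iterSr /= n1 => ->.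
Qed.

Lemma tail_output st (L X : seq 'I_n) (s := run tail st) :
    graph_state n (star e) st -> hamilton_oriented_cycle e (L ++ rev X) ->
    vars st vQ = size X ->
    (forall i, i < size L -> arrs st aOut i = nth n (map val L) i) ->
    (forall i, i < size X -> arrs st aQ i = nth n (map val X) i) ->
  outputs s (L ++ rev X).
Proof.
move=> gst hR qX OL QX; have n0 : vars st 0 = n by case: gst.
have szR : size L + size X = n.
  by rewrite -[RHS]card_ord -(hamilton_cycle_size hR) size_cat size_rev.
have := @tail_spec n st n0; rewrite qX => /(_ (leq_trans (leq_addl _ _) (eq_leq szR))) t.
rewrite /outputs size_cat size_rev szR map_cat map_rev; apply: (@eq_from_nth _ n).
  by rewrite size_mkseq size_cat size_rev !size_map.
move=> i; rewrite size_cat size_rev !size_map szR => il.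
rewrite nth_mkseq // /s t // nth_cat size_map.
have iX := suffix_index szR il; have [iL|Li] := ltnP i (size L).
  by rewrite iX [size L <= i]leqNgt iL OL.
have [rX rE] := rev_suffix_index szR Li il.
rewrite iX Li QX; last by rewrite iX.
by rewrite nth_rev size_map ?rE.
Qed.

Lemma nonstrong_prog_spec st (s := run nonstrong_prog st) :
    ~~ strong e -> k_connected 2 e -> graph_state n (star e) st ->
    excluded n pred0 st -> vars st vStart = n ->
  exists R, [/\ outputs s R, hamilton_oriented_cycle e R
    & forall r, hamilton_oriented_cycle e r -> forward_arcs e r <= forward_arcs e R].
Proof.
move=> nS c2 g0 ex0 x0; rewrite /s /nonstrong_prog 3!run_seq.
set s1 := run (path_prog aPath) st.
have fr1 : frame [:: 2; 3; 4; 5; 6; 7; 9] [:: 4; 5; 6; 8] st s1.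
  by apply: frame_sub (run_frame (path_prog aPath) st) _ _; apply/allP.
have c0 : connected_on e (~: [set x in [::]]).
  by rewrite (_ : ~: _ = [set: 'I_n]) //; apply/setP=> x; rewrite !inE.
have [l [Ul sl lE nx1]] := path_prog_spec (a := aPath) isT c0 g0 ex0 x0.
have {}lE : forall v, v \in l by move=> v; rewrite lE.
have szl : size l = n by rewrite -[RHS]card_ord -(card_uniqP Ul); apply: eq_card => v; rewrite lE.
case: l => [|h p] in Ul sl lE szl nx1 *; first by exfalso; move: (n3); rewrite -szl.
have ps1 : path_stored h p s1.
  by move=> i il; rewrite nx1 ?szl // (nth_map h) // szl.
have g1 : graph_state n (star e) s1 by apply: graph_frame fr1 _ _ _ g0.
have ex1 : excluded n pred0 s1 by apply: excluded_frame fr1 _ ex0.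
have x1 : vars s1 vStart = n by rewrite (proj1 fr1).
clearbody s1; clear fr1 nx1.
have tot u v : connect e u v || connect e v u by apply: (sorted_connect_total sl).
have src v : connect e h v by exact: (path_connect (sl : path e h p) (lE v)).
have snk v : connect e v (last h p) by apply: (path_connect_last (sl : path e h p)).
have nth' : ~~ connect e (last h p) h.
  apply: contra nS => th; apply/strongP=> u v.
  exact: connect_trans (snk u) (connect_trans th (src v)).
set s2 := run greedy s1.
have fr2 : frame [:: 2; 5; 9; 10; 11; 12] [:: 7; 9] s1 s2.
  by apply: frame_sub (run_frame greedy s1) _ _; apply/allP.
have [X [gP ex2 q2 Q2]] := greedy_spec lsd sl Ul lE nth' g1 ps1 ex1.
rewrite -/s2 in ex2 q2 Q2.
have g2 : graph_state n (star e) s2 by apply: graph_frame fr2 _ _ _ g1.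
have x2 : vars s2 vStart = n by rewrite (proj1 fr2).
clearbody s2.
have cX := greedy_complement_connected lsd tot gP (fun u a b => @two_connected_remove _ e u a b c2).
set s3 := run (path_prog aOut) s2.
have fr3 : frame [:: 2; 3; 4; 5; 6; 7; 9] [:: 1; 4; 5; 6] s2 s3.
  by apply: frame_sub (run_frame (path_prog aOut) s2) _ _; apply/allP.
have [L [UL sL LX nx3]] := path_prog_spec (a := aOut) isT cX g2 ex2 x2.
rewrite -/s3 in nx3.
have g3 : graph_state n (star e) s3 by apply: graph_frame fr3 _ _ _ g2.
have q3 : vars s3 vQ = size X by rewrite (proj1 fr3).
have Q3 i : i < size X -> arrs s3 aQ i = nth n (map val X) i.
  by move=> iX; rewrite (proj2 fr3) // Q2 // (nth_map h).
clearbody s3.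
have [hR fR] := greedy_cycle lsd gP sL UL LX.
exists (L ++ rev X); split=> //; first exact: tail_output.
by move=> r /(greedy_upper lsd gP) /leq_trans; apply; exact: fR.
Qed.

Lemma nonstrong_start_spec st
    (s := run (PPut aExcl (Var vN) (Cst 0) ;; PAssign vStart (Var vN) ;; nonstrong_prog) st) :
    ~~ strong e -> k_connected 2 e -> graph_state n (star e) st -> excluded n (pred1 n) st ->
  exists R, [/\ outputs s R, hamilton_oriented_cycle e R
    & forall r, hamilton_oriented_cycle e r -> forward_arcs e r <= forward_arcs e R].
Proof.
move=> nS c2 g ex; have n0 : vars st 0 = n by case: g.
rewrite /s 2!run_seq; set s1 := run (PPut _ _ _) st; set s2 := run (PAssign vStart _) s1.
have fr : frame [:: 1] [:: 7] st s2.
  exact: (run_frame (PPut aExcl (Var vN) (Cst 0) ;; PAssign vStart (Var vN)) st).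
have g2 : graph_state n (star e) s2 by apply: graph_frame fr _ _ _ g.
have x2 : vars s2 vStart = n by exact: n0.
apply: nonstrong_prog_spec => //.
move=> v vn; have -> : arrs s2 aExcl v = if v == n then 0 else arrs st aExcl v by rewrite -n0.
by rewrite ex //=; case: eqP.
Qed.

Lemma strong_output_spec st L (s := run (PAssign vCur (Cst 0) ;; walk aOut) st) :
    graph_state n (star e) st -> cycle_state n (star e) (pred1 n) st L ->
    (forall v, v < n -> v \in L) ->
  exists R, [/\ outputs s R, hamilton_oriented_cycle e R
    & forall r, hamilton_oriented_cycle e r -> forward_arcs e r <= forward_arcs e R].
Proof.
move=> g [UL aL cL rL _] covered; have n0 : vars st 0 = n by case: g.
have [i q LE] := rot_to (covered 0 (leq_trans (isT : 0 < 3) n3)).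
have [|R RE] := @map_val_ord n (0 :: q).
  apply/allP=> u; rewrite -LE mem_rot => /(allP aL) /andP[un uN].
  by rewrite ltn_neqAle un andbT.
have UR : uniq R by rewrite -(map_inj_uniq val_inj) -RE -LE rot_uniq.
have RT v : v \in R.
  by rewrite -(mem_map val_inj) -RE -LE mem_rot; apply: covered; apply: ltn_ord.
have szR : size R = n by rewrite -[RHS]card_ord -(card_uniqP UR); apply: eq_card => v; rewrite RT.
have cR : cycle e R.
  apply: cycle_irreflexive => //; first by rewrite szR; apply: leq_trans n3.
  by rewrite -cycle_star -RE -LE rot_cycle.
have hR : hamilton_oriented_cycle e R.
  apply/andP; split; last exact/forallP.
  by apply/andP; split=> //; apply: sub_cycle cR => u v; rewrite /adjacent /= => ->.
exists R; split=> // [|r hr]; last first.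
  have szr : size r = n by rewrite (hamilton_cycle_size hr) card_ord.
  by rewrite (forward_arcs_cycle cR) szR; apply: leq_trans (eq_leq szr); apply: forward_arcs_size.
rewrite /s run_seq; set s1 := run (PAssign vCur _) st.
have w1 := @walk_spec n aOut s1 n0 isT.
have r1 : ring (arrs s1 aNext) (0 :: q) by rewrite -LE; apply/ring_rot.
have szq : (size q).+1 = n by rewrite -szR -[RHS](size_map val) -RE.
have cur1 : vars s1 vCur = 0 by [].
rewrite /outputs -RE szR; apply: (@eq_from_nth _ 0) => [|j].
  by rewrite size_mkseq -szq.
rewrite [size _]szq => jl; rewrite nth_mkseq // w1 1?ltnW //.
by rewrite cur1 (ring_iter 0 r1) // -ltnS szq.
Qed.

Lemma ears_check_spec st (s := run check (run ears st)) :
    graph_state n (star e) st -> excluded n (pred1 n) st -> vars st vStart = 0 ->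
  [/\ graph_state n (star e) s, excluded n (pred1 n) s
    & if vars s vDone != 0 then
        exists2 L, cycle_state n (star e) (pred1 n) s L & forall v, v < n -> v \in L
      else ~~ strong e].
Proof.
move=> g ex x0; rewrite {}/s; set s1 := run ears st; set s2 := run check s1.
have fr1 : frame [:: 2; 3; 4; 5; 6; 7] [:: 4; 5; 6] st s1.
  by apply: frame_sub (run_frame ears st) _ _; apply/allP.
have fr2 : frame [:: 6; 11] [::] s1 s2.
  by apply: frame_sub (run_frame check s1) _ _; apply/allP.
have g1 : graph_state n (star e) s1 by apply: graph_frame fr1 _ _ _ g.
have n1 : vars s1 0 = n by case: g1.
have := ears_spec g ex; rewrite x0 -/s1 => /(_ (leq0n n)) [|L [[UL aL cL rL mL] L0 cov]].
  by rewrite /= eq_sym -lt0n (leq_trans _ n3).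
have done2 : vars s2 vDone = all (fun v => (v \in L) || pred1 n v) (iota 0 n.+1).
  exact: check_spec.
split; [by apply: graph_frame fr2 _ _ _ g1| |].
  by apply: excluded_frame fr2 _ _ => //; apply: excluded_frame fr1 _ ex.
rewrite done2 eqb0 negbK; case: ifPn => [/allP covered|uncovered]; last first.
  apply: contra uncovered => eS; apply/allP=> v.
  by rewrite mem_iota ltnS => vn; apply: cov => //; apply: extendable_strong.
exists L => [|v vn].
  split=> //; last by apply: marks_frame fr2 _ mL.
  by rewrite /ring -rL; apply: eq_map => v; rewrite (proj2 fr2).
have := covered v; rewrite mem_iota ltnS (ltnW vn) => /(_ isT)/orP[//|/= /eqP vE].
by rewrite vE ltnn in vn.
Qed.

Lemma setup_excl_spec (s := run (PPut aExcl (Var vN) (Cst 1)) (run setup (input_state e))) :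
  [/\ graph_state n (star e) s, excluded n (pred1 n) s & vars s vStart = 0].
Proof.
have [g1 ex1] := setup_spec e; rewrite {}/s; move: g1 ex1.
have : vars (run setup (input_state e)) vStart = 0 by rewrite (proj1 (run_frame setup _)).
move: (run setup (input_state e)) => st x1 g1 ex1; set s := run _ st.
have n1 : vars st 0 = n by case: g1.
split=> // v vn; have -> : arrs s aExcl v = if v == n then 1 else arrs st aExcl v by rewrite -n1.
by rewrite ex1 /=; case: (v == n).
Qed.

Lemma hamilton_prog_spec (s := run hamilton_prog (input_state e)) :
    k_connected 2 e ->
  exists R, [/\ outputs s R, hamilton_oriented_cycle e R
    & forall r, hamilton_oriented_cycle e r -> forward_arcs e r <= forward_arcs e R].
Proof.
move=> c2; rewrite /s /hamilton_prog 4!run_seq.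
have [g1 ex1 x1] := setup_excl_spec; have [g2 ex2] := ears_check_spec g1 ex1 x1.
move: (run check _) g2 ex2 => st g2 ex2; rewrite run_if -[eval st _]/(vars st vDone).
case: ifP => _; last by move=> nS; apply: nonstrong_start_spec.
by case=> L; apply: strong_output_spec.
Qed.

End Correctness.

Lemma hamilton_prog_polynomial : exists c k, forall n (e : rel 'I_n), 0 < n ->
  exists2 t, exec (compile hamilton_prog) (input_state e) t (run hamilton_prog (input_state e))
    & t <= c * digraph_size e ^ k.
Proof.
have [c [k ck]] := cost_polynomial hamilton_prog.
exists (c * 2 ^ k), k => n e n0.
have [//|t et tc] := @compile_exec hamilton_prog (input_state e).
exists t => //; apply: leq_trans tc _; apply: leq_trans (ck _ _) _ => //.
rewrite -mulnA -expnMn leq_mul2l; apply/orP; right.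
have : (vars (input_state e) 0).+1 <= 2 * digraph_size e.
  by rewrite /digraph_size card_ord /=; lia.
by case: (k) => [|k'] // le; rewrite leq_exp2r.
Qed.

Theorem theorem1p6 :
  (forall (T : finType) (e : rel T) (Cs : seq {set T}),
      irreflexive e -> connected e -> locally_semicomplete e -> 3 <= #|T| ->
      acyclic_ordering e Cs ->
      [/\ ~~ strong e -> k_connected 2 e ->
            exists2 d, is_set_dist e (head set0 Cs) (last set0 Cs) d
                     & sigma_hc_max e = #|T| - d,
          ~~ strong e -> ~~ k_connected 2 e -> sigma_hc_max e = 0
        & strong e -> sigma_hc_max e = #|T|])
  /\
  (exists (P : cmd) (c k : nat),
    forall (n : nat) (e : rel 'I_n),
      irreflexive e -> connected e -> locally_semicomplete e -> 3 <= n ->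
      (exists s : seq 'I_n, hamilton_oriented_cycle e s) ->
      exists (t : nat) (st : state) (R : seq 'I_n),
        [/\ exec P (input_state e) t st,
            t <= c * digraph_size e ^ k,
            outputs st R,
            hamilton_oriented_cycle e R
          & forall s : seq 'I_n, hamilton_oriented_cycle e s ->
              forward_arcs e s <= forward_arcs e R]).
Proof.
split; first exact: sigma_hc_max_spec.
have [c [k poly]] := hamilton_prog_polynomial.
exists (compile hamilton_prog), c, k => n e _ conn lsd n3 [s hs].
have [|t et tc] := poly n e; first exact: leq_trans n3.
have [|R [oR hR maxR]] := hamilton_prog_spec lsd conn n3.
  by apply: hamilton_two_connected hs; rewrite card_ord.
by exists t, (run hamilton_prog (input_state e)), R.
Qed.
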